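(* An $n$-sequence $\gamma = (\gamma_\alpha)_{\alpha \in \mathbf{Z}_+^n}$ ($\gamma_0 > 0$) is a moment sequence if and only if there exists a positive semi-definite $(n+1)$-sequence $\delta = (\delta_{(\alpha,\beta)})_{(\alpha,\beta) \in \mathbf{Z}_+^n \times \mathbf{Z}_+}$ with the following properties: (1) $\gamma_\alpha = \delta_{(\alpha,0)}$ for all $\alpha \in \mathbf{Z}_+^n$. (2) $\delta_{(\alpha,\beta)} = \delta_{(\alpha,\beta+1)} + \delta_{(\alpha+2e_1,\beta+1)} + \cdots + \delta_{(\alpha+2e_n,\beta+1)}$ for all $\alpha \in \mathbf{Z}_+^n$, $\beta \in \mathbf{Z}_+$. The $n$-sequence $\gamma$ has a uniquely determined representing measure in $\mathbf{R}^n$ if and only if the $(n+1)$-sequence $\delta$ (satisfying these properties) is unique.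
   Context: $n \ge 1$ is a fixed integer; $\mathbf{Z}_+$ is the set of nonnegative integers; $t^\alpha = t_1^{\alpha_1}\cdots t_n^{\alpha_n}$; $e_j \in \mathbf{Z}_+^n$ is the multi-index whose coordinates are null except the $j$th, which equals $1$. For $N \ge 1$, $\mathcal{P}_N$ is the algebra of polynomial functions on $\mathbf{R}^N$ with complex coefficients. An $N$-sequence is a family of scalars $\gamma = (\gamma_\alpha)_{\alpha \in \mathbf{Z}_+^N}$; it is positive semi-definite if the associated linear map $L_\gamma : \mathcal{P}_N \to \mathbf{C}$, $L_\gamma(t^\alpha) = \gamma_\alpha$, satisfies $L_\gamma(f\bar f) \ge 0$ for all $f \in \mathcal{P}_N$. An $n$-sequence $\gamma$ is a moment sequence if there is a positive Borel measure $\mu$ on $\mathbf{R}^n$ (a representing measure for $\gamma$) such that $\mathcal{P}_n \subset L^2(\mu)$ and $\gamma_\alpha = \int t^\alpha\, d\mu(t)$ for all $\alpha \in \mathbf{Z}_+^n$. *)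

(* Defs.v *)
From mathcomp Require Import all_boot all_order all_algebra.
From mathcomp Require Import complex.
(* The notations of mpoly.v clash with those of MathComp-Analysis. *)
From mathcomp Require Import -(notations) mpoly.
From mathcomp Require Import all_classical all_reals all_analysis.
Set Implicit Arguments.
Unset Strict Implicit.
Unset Printing Implicit Defensive.
Import Order.TTheory GRing.Theory Num.Theory.
Import numFieldNormedType.Exports.
Local Open Scope classical_set_scope.
Local Open Scope ring_scope.

(* Scalars are in [R[i]], the complex numbers over [R]. *)
Definition mseq (R : realType) (N : nat) := multinom N -> R[i].

Definition mfunctional (R : realType) (N : nat) (gamma : mseq R N)
    (p : mpoly N R[i]) : R[i] :=
  \sum_(m <- msupp p) mcoeff m p * gamma m.

Definition conj_mpoly (R : realType) (N : nat) (p : mpoly N R[i]) :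
    mpoly N R[i] :=
  map_mpoly (@conjc R) p.

(* The order of [R[i]]: [0 <= z] means that z is real and nonnegative. *)
Definition psd_mseq (R : realType) (N : nat) (gamma : mseq R N) : Prop :=
  forall f : mpoly N R[i], 0 <= mfunctional gamma (f * conj_mpoly f).

Definition borelRn (R : realType) (n : nat) :=
  g_sigma_algebraType (@open 'rV[R]_n).

Definition mpoly_fun (R : realType) (n : nat) (p : mpoly n R[i])
    (t : 'rV[R]_n) : R[i] :=
  meval (fun j => (t ord0 j)%:C%C) p.

Definition monomial_fun (R : realType) (n : nat) (alpha : multinom n)
    (t : 'rV[R]_n) : R :=
  \prod_(j < n) t ord0 j ^+ alpha j.

(* The L^p classes of MathComp-Analysis only contain real-valued functions. *)
Definition in_L2 (d : measure_display) (T : measurableType d) (R : realType)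
    (mu : {measure set T -> \bar R}) (f : T -> R[i]) : Prop :=
  [/\ measurable_fun [set: T] (fun x => complex.Re (f x)),
      measurable_fun [set: T] (fun x => complex.Im (f x)) &
      (\int[mu]_x ((ComplexField.Normc.normc (f x)) ^+ 2)%:E < +oo)%E].

Definition representing_measure (R : realType) (n : nat) (gamma : mseq R n)
    (mu : {measure set (borelRn R n) -> \bar R}) : Prop :=
  (forall p : mpoly n R[i], in_L2 mu (mpoly_fun p)) /\
  (forall alpha : multinom n,
     gamma alpha = (\int[mu]_(t in [set: borelRn R n]) monomial_fun alpha t)%:C%C).

Definition moment_mseq (R : realType) (n : nat) (gamma : mseq R n) : Prop :=
  exists mu : {measure set (borelRn R n) -> \bar R},
    representing_measure gamma mu.

(* Two measures are identified when they agree on the Borel sets: their values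
   elsewhere are irrelevant. *)
Definition unique_representing_measure (R : realType) (n : nat)
    (gamma : mseq R n) : Prop :=
  exists mu : {measure set (borelRn R n) -> \bar R},
    representing_measure gamma mu /\
    forall nu : {measure set (borelRn R n) -> \bar R},
      representing_measure gamma nu ->
      forall A : set (borelRn R n), measurable A -> nu A = mu A.

(* (alpha, beta) as a multi-index of length n + 1, with beta in last position. *)
Definition mpair (n : nat) (alpha : multinom n) (beta : nat) :
    multinom n.+1 :=
  mnm_add (mnmwiden alpha) (mnm_muln (mnm1 ord_max) beta).

Definition dim_extension (R : realType) (n : nat) (gamma : mseq R n)
    (delta : mseq R n.+1) : Prop :=
  [/\ psd_mseq delta,
      forall alpha : multinom n, gamma alpha = delta (mpair alpha 0) &
      forall (alpha : multinom n) (beta : nat),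
        delta (mpair alpha beta) =
          delta (mpair alpha beta.+1) +
          \sum_(j < n)
            delta (mpair (mnm_add alpha (mnm_muln (mnm1 j) 2)) beta.+1)].

(* Main.v *)
(* Write s for 1 / (1 + |t|^2), so that delta_(alpha, beta) stands for the
   integral of t^alpha s^beta.  Positivity on squares together with the relation
   s (1 + |t|^2) = 1 makes s, 1 - s and 1/2 +- t_j s sums of squares modulo the
   kernel of L_delta, hence L_delta is nonnegative on all products of the
   variables x = (s, 1/2 + t_j s) and of their complements 1 - x.  By de Finetti's
   argument such a functional comes from a measure on the cube: these products
   prescribe the joint law of random bits (realized on an interval with Lebesgue
   measure), and x is recovered as the limit of averages of the bits.  The
   estimate L((1 - s)^N) <= L(1 + |t|^2) / N shows that s = 0 has measure zero, so
   t = (t s) / s is defined almost everywhere, and monotone convergence along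
   the cutoffs (1 - (1 - s)^N)^r extends the representation to all t^alpha s^beta.
   Finally a measure is determined by the integrals of the t^alpha s^beta,
   because the indicator of t_j < a is a bounded pointwise limit of polynomials
   in (a - t_j) s: iterate x |-> (3 x - x^3) / 2. *)
Require Import Defs.
From HB Require Import structures.
From mathcomp Require Import all_boot all_order all_algebra.
From mathcomp Require Import complex.
From mathcomp Require Import -(notations) mpoly.
From mathcomp Require Import all_classical all_reals all_analysis.
From mathcomp Require Import measurable_realfun.
From mathcomp Require Import ring lra.
Set Implicit Arguments.
Unset Strict Implicit.
Unset Printing Implicit Defensive.
Import Order.TTheory GRing.Theory Num.Theory.
Import numFieldNormedType.Exports.
Local Open Scope classical_set_scope.
Local Open Scope ring_scope.

(** * Random bits with joint probabilities given by a functional *)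

(** In several variables positivity on squares does not by itself yield a measure. The extra
    variable helps because s (1 + |t|^2) = 1 places (s, t s) on the sphere S^2 + |U|^2 = S: bounded
    variables suffice, and their bounds are themselves consequences of positivity. Products of
    factors x and 1 - x have nonnegative weights that add up through x + (1 - x) = 1, so they cut
    [0, L 1[ into consistent nested pieces, and the bits become explicit step functions of one real
    variable. The price is that T = U / S is unbounded again; the decay of L (f (1 - s)^N) for every
    positive f, not just f = 1, is what carries the moments through the limit. The uniqueness
    statement rests on a bijection: a representing measure mu of gamma gives [extension_of mu], and
    each delta is represented by exactly one measure. The moments of t^alpha alone may fail to
    determine mu; together with the powers of s they do. *)

Lemma bounded_integrable d (T : measurableType d) (R : realType)
    (mu : {measure set T -> \bar R}) (D : set T) (f : T -> R) (M : R) :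
  measurable D -> (mu D < +oo)%E -> measurable_fun D f ->
  (forall x, D x -> `|f x| <= M) -> mu.-integrable D (EFin \o f).
Proof.
move=> mD muD mf fM; apply: measurable_bounded_integrable => //.
exists M; split; first by rewrite num_real.
by move=> y My x /= Dx; rewrite (le_trans (fM _ Dx))// ltW.
Qed.

Lemma Rintegral_mrestr d (T : measurableType d) (R : realType)
    (mu : {measure set T -> \bar R}) (D : set T) (mD : measurable D) (f : T -> R) (M : R) :
  (mu D < +oo)%E -> measurable_fun [set: T] f -> (forall x, `|f x| <= M) ->
  \int[mrestr mu mD]_x f x = \int[mu]_(x in D) f x.
Proof.
move=> muD mf fM; rewrite /Rintegral; congr fine.
rewrite (negligible_integral (N := ~` D))//; first last.
- by change (mu (~` D `&` D) = 0%E); rewrite setICl measure0.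
- apply: (bounded_integrable (M := M)) => //.
  by change (mu (setT `&` D) < +oo)%E; rewrite setTI.
- exact: measurableC.
rewrite setTD setCK; apply: eq_measure_integral => A mA AD.
by change (mu (A `&` D) = mu A); rewrite setIidl.
Qed.

Section Bits.
Context (R : realType) (A : comAlgType R) (L : {scalar A}).
Variables (C : A -> Prop) (x : nat -> A).
Hypothesis C_ge0 : forall g, C g -> 0 <= L g.
Hypothesis CMx : forall g k, C g -> C (g * x k).
Hypothesis CM1x : forall g k, C g -> C (g * (1 - x k)).

Definition digit (b w : R) : R := (b <= w)%R%:R.

(** Once the factors before index [k] are read, [w] is meant to lie in [a, a + L g[, where [g] is
    the product of the factors x or 1 - x chosen so far. The index [j] is relative: it designates
    the bit of [x (k + j)]. *)
Fixpoint bit (k : nat) (a : R) (g : A) (j : nat) (w : R) : R :=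
  let b := a + L (g * (1 - x k)) in
  if j is j'.+1 then
    (1 - digit b w) * bit k.+1 a (g * (1 - x k)) j' w +
    digit b w * bit k.+1 b (g * x k) j' w
  else digit b w.

Lemma measurable_digit b : measurable_fun [set: R] (digit b).
Proof.
rewrite (_ : digit b = \1_(`[b, +oo[%classic)); first exact: measurable_indic.
by apply/funext => w; rewrite indicE /digit mem_setE in_itv /= andbT.
Qed.

Lemma digit_01 b w : digit b w = 0 \/ digit b w = 1.
Proof. by rewrite /digit; case: (b <= w); [right|left]. Qed.

Lemma bit_01 k a g j w : bit k a g j w = 0 \/ bit k a g j w = 1.
Proof.
elim: j k a g => [|j IH] k a g /=; first exact: digit_01.
set b := a + _; case: (digit_01 b w) => ->.
  by rewrite mul0r addr0 subr0 mul1r.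
by rewrite subrr mul0r add0r mul1r.
Qed.

Lemma measurable_bit k a g j : measurable_fun [set: R] (bit k a g j).
Proof.
elim: j k a g => [|j IH] k a g /=; first exact: measurable_digit.
by apply: measurable_funD; apply: measurable_funM => //;
  [apply: measurable_funB => //; exact: measurable_digit|exact: measurable_digit].
Qed.

Lemma measurable_bit_prod k a g N (S : pred nat) :
  measurable_fun [set: R] (fun w => \prod_(j < N | S j) bit k a g j w).
Proof.
under eq_fun do rewrite big_mkcond.
by apply: measurable_prod => j _; case: (S j) => //; exact: measurable_bit.
Qed.

Lemma bit_prod_le1 k a g N (S : pred nat) w :
  `|\prod_(j < N | S j) bit k a g j w| <= 1.
Proof.
rewrite normr_prod; apply: prodr_ile1 => j _.
by case: (bit_01 k a g j w) => ->; rewrite ?normr0 ?normr1 ?lexx ?ler01.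
Qed.

Lemma integrable_bit_prod (a b : R) k a' g N (S : pred nat) :
  (@lebesgue_measure R).-integrable `[a, b[%classic
    (EFin \o (fun w => \prod_(j < N | S j) bit k a' g j w)).
Proof.
apply: (bounded_integrable (M := 1)) => //.
- by rewrite /= lebesgue_measure_itv/=; case: ifP => _; rewrite ?ltry.
- by apply: measurable_funTS; exact: measurable_bit_prod.
- by move=> w _; exact: bit_prod_le1.
Qed.

(* The left part of the interval, on which the first bit is 0, has length
   L (g * (1 - x k)); the right part, on which it is 1, has length L (g * x k). *)
Lemma integral_bit_prod N k a g (S : pred nat) : C g ->
  \int[@lebesgue_measure R]_(w in `[a, a + L g[%classic)
     \prod_(j < N | S j) bit k a g j w =
  L (g * \prod_(j < N | S j) x (k + j)).
Proof.
elim: N k a g S => [|N IH] k a g S Cg.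
  rewrite [LHS](@eq_Rintegral _ _ _ _ _ (cst 1)).
    rewrite Rintegral_cst//= big_ord0 mulr1 mul1r lebesgue_measure_itv /= lte_fin.
    have := C_ge0 Cg; case: ltrgt0P => [Lg|//|->] _.
      by rewrite ltrDl Lg -EFinD /= addrC addKr.
    by rewrite addr0 ltxx.
  by move=> w _; rewrite big_ord0.
have Lg : L g = L (g * (1 - x k)) + L (g * x k).
  by rewrite -linearD -mulrDr subrK mulr1.
set b := a + L (g * (1 - x k)).
have ab : a <= b by rewrite /b lerDl; apply/C_ge0/CM1x.
have bc : b <= a + L g by rewrite /b Lg addrA lerDl; apply/C_ge0/CMx.
rewrite (@itv_bndbnd_setU _ _ _ (BLeft b)) ?bnd_simp//.
rewrite Rintegral_setU//=; first last.
- apply/disj_setPS => w /=; rewrite !in_itv /= => -[/andP[_ wb] /andP[bw _]].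
  by move: (lt_le_trans wb bw); rewrite ltxx.
- by rewrite -itv_bndbnd_setU ?bnd_simp//; exact: integrable_bit_prod.
pose S' j := S j.+1.
have Eg (h : A) : L (h * \prod_(j < N.+1 | S j) x (k + j)) =
    L (h * (if S 0 then x k else 1) * \prod_(j < N | S' j) x (k.+1 + j)).
  rewrite big_mkcond big_ord_recl /= addn0 mulrA; congr (L (_ * _)).
  rewrite [RHS]big_mkcond; apply: eq_bigr => j _.
  by rewrite /S' /bump /= add1n addnS addSn.
have El : {in `[a, b[%classic, (fun w => \prod_(j < N.+1 | S j) bit k a g j w) =1
    (fun w => (if S 0 then 0 else 1) *
       \prod_(j < N | S' j) bit k.+1 a (g * (1 - x k)) j w)}.
  move=> w; rewrite mem_setE in_itv /= => /andP[_ wb].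
  rewrite big_mkcond big_ord_recl /= -/b /digit leNgt wb /=; congr (_ * _).
  rewrite [RHS]big_mkcond; apply: eq_bigr => j _.
  rewrite /S' /bump /= add1n /= add0n.
  by rewrite subr0 mul1r mul0r addr0.
have Er : {in `[b, a + L g[%classic, (fun w => \prod_(j < N.+1 | S j) bit k a g j w) =1
    (fun w => \prod_(j < N | S' j) bit k.+1 b (g * x k) j w)}.
  move=> w; rewrite mem_setE in_itv /= => /andP[bw _].
  rewrite big_mkcond big_ord_recl /= -/b /digit bw /=.
  rewrite [X in X * _](_ : _ = 1) ?mul1r; last by case: (S 0).
  rewrite [RHS]big_mkcond; apply: eq_bigr => j _.
  by rewrite /S' /bump /= add1n /= add0n subrr mul1r mul0r add0r.
have -> : \int[lebesgue_measure]_(w in `[a, b[) \prod_(j < N.+1 | S j) bit k a g j w =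
    (if S 0 then 0 else 1) * L (g * (1 - x k) * \prod_(j < N | S' j) x (k.+1 + j)).
  rewrite -(IH _ a); last exact: CM1x.
  rewrite -RintegralZl//; last exact: integrable_bit_prod.
  exact: eq_Rintegral.
have -> : \int[lebesgue_measure]_(w in `[b, a + L g[)
    \prod_(j < N.+1 | S j) bit k a g j w =
    L (g * x k * \prod_(j < N | S' j) x (k.+1 + j)).
  rewrite -(IH _ b); last exact: CMx.
  rewrite (_ : b + L (g * x k) = a + L g); last by rewrite Lg addrA.
  exact: eq_Rintegral.
(* If S selects the first index, only the right part contributes; otherwise the two parts recombine
   through (1 - x k) + x k = 1. *)
rewrite Eg; case: (S 0).
  by rewrite mul0r add0r.
by rewrite mul1r mulr1 -linearD -mulrDl -mulrDr subrK mulr1.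
Qed.

End Bits.

(* Reading the bits of a point w of [0, L 1[ off the nested intervals turns the
   numbers L (\prod_(k in S) x k) into joint probabilities. *)
Lemma bits_of_functional (R : realType) (A : comAlgType R) (L : {scalar A})
    (C : A -> Prop) (x : nat -> A) :
  (forall g, C g -> 0 <= L g) ->
  (forall g k, C g -> C (g * x k)) ->
  (forall g k, C g -> C (g * (1 - x k))) -> C 1 ->
  exists (P : {measure set (measurableTypeR R) -> \bar R}) (B : nat -> R -> R),
  [/\ (P setT < +oo)%E,
      forall k, measurable_fun [set: measurableTypeR R] (B k),
      forall k w, B k w = 0 \/ B k w = 1 &
      forall S : seq nat, uniq S ->
        \int[P]_w \prod_(k <- S) B k w = L (\prod_(k <- S) x k)].
Proof.
move=> C0 CM CM1 C1.
pose mD : measurable (`[0, L 1[%classic : set (measurableTypeR R)) :=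
  measurable_itv _.
have finD : ((@lebesgue_measure R) `[0%R, L 1%R[%classic < +oo)%E.
  by rewrite /= lebesgue_measure_itv/=; case: ifP => _; rewrite ?ltry.
exists (mrestr (@lebesgue_measure R) mD), (bit L x 0 0 1).
split => [|||S uS].
- by change ((@lebesgue_measure R) (setT `&` `[0%R, L 1%R[%classic) < +oo)%E; rewrite setTI.
- by move=> k; exact: measurable_bit.
- by move=> k w; exact: bit_01.
pose N := (\max_(k <- S) k).+1.
have SN k : k \in S -> (k < N)%N.
  by move=> kS; rewrite ltnS; exact: leq_bigmax_seq.
have E (V : comPzRingType) (F : nat -> V) :
    \prod_(k <- S) F k = \prod_(j < N | (j : nat) \in S) F j.
  rewrite -(big_mkord (fun j => j \in S) F) /index_iota subn0 -[RHS]big_filter.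
  apply: perm_big; apply: uniq_perm => //.
    by rewrite filter_uniq// iota_uniq.
  move=> k; rewrite mem_filter mem_iota add0n /=.
  by case kS: (k \in S) => //=; rewrite SN.
rewrite E -[RHS](congr1 L (mul1r _)).
have := @integral_bit_prod _ _ L C x C0 CM CM1 N 0 0 1 (mem S) C1.
rewrite add0r => <-.
rewrite -(@Rintegral_mrestr _ _ _ _ _ mD _ 1)//.
- by apply: eq_Rintegral => w _; rewrite E.
- exact: measurable_bit_prod.
- by move=> w; exact: bit_prod_le1.
Qed.

(** * Bounded measurable functions and block averages *)

Section BoundedMeasurable.
Context d (T : measurableType d) (R : realType) (P : {measure set T -> \bar R}).
Hypothesis finP : (P setT < +oo)%E.

(** Over a finite measure these functions form an algebra of integrable functions, so integrability
    obligations reduce to closure properties. *)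
Definition bounded_measurable (f : T -> R) :=
  measurable_fun [set: T] f /\ exists M, forall w, `|f w| <= M.

Local Notation bm := bounded_measurable.
Local Notation E f := (Rintegral P setT f).

Lemma bm_integrable f : bm f -> P.-integrable setT (EFin \o f).
Proof. by move=> [mf [M fM]]; apply: (bounded_integrable (M := M)). Qed.

Lemma bm_cst c : bm (fun=> c).
Proof. by split; [exact: measurable_cst|exists `|c|]. Qed.

Lemma bmD f g : bm f -> bm g -> bm (fun w => f w + g w).
Proof.
move=> [mf [M fM]] [mg [N gN]]; split; first exact: measurable_funD.
by exists (M + N) => w; rewrite (le_trans (ler_normD _ _))// lerD.
Qed.

Lemma bmM f g : bm f -> bm g -> bm (fun w => f w * g w).
Proof.
move=> [mf [M fM]] [mg [N gN]]; split; first exact: measurable_funM.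
by exists (M * N) => w; rewrite normrM ler_pM.
Qed.

Lemma bmN f : bm f -> bm (fun w => - f w).
Proof.
move=> bf; rewrite (_ : (fun _ => _) = (fun w => (-1) * f w)).
  by apply: bmM => //; exact: bm_cst.
by apply/funext => w; rewrite mulN1r.
Qed.

Lemma bmB f g : bm f -> bm g -> bm (fun w => f w - g w).
Proof. by move=> bf bg; apply: bmD => //; exact: bmN. Qed.

Lemma bm_prod (I : Type) (s : seq I) (Q : pred I) (F : I -> T -> R) :
  (forall i, bm (F i)) -> bm (fun w => \prod_(i <- s | Q i) F i w).
Proof.
move=> bF; elim: s => [|i s IH].
  by under eq_fun do rewrite big_nil; exact: bm_cst.
under eq_fun do rewrite big_cons.
by case: (Q i) => //; exact: bmM.
Qed.

Lemma bm_sum (I : Type) (s : seq I) (Q : pred I) (F : I -> T -> R) :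
  (forall i, bm (F i)) -> bm (fun w => \sum_(i <- s | Q i) F i w).
Proof.
move=> bF; elim: s => [|i s IH].
  by under eq_fun do rewrite big_nil; exact: bm_cst.
under eq_fun do rewrite big_cons.
by case: (Q i) => //; exact: bmD.
Qed.

Lemma bmX f n : bm f -> bm (fun w => f w ^+ n).
Proof.
move=> bf; elim: n => [|n IH].
  by under eq_fun do rewrite expr0; exact: bm_cst.
by under eq_fun do rewrite exprS; exact: bmM.
Qed.

Lemma bm_norm f : bm f -> bm (fun w => `|f w|).
Proof.
move=> [mf [M fM]]; split; first exact: measurableT_comp.
by exists M => w; rewrite normr_id.
Qed.

Lemma Rintegral_bmD f g : bm f -> bm g -> E (fun w => f w + g w) = E f + E g.
Proof. by move=> bf bg; rewrite RintegralD//; exact: bm_integrable. Qed.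

Lemma Rintegral_bmZ c f : bm f -> E (fun w => c * f w) = c * E f.
Proof. by move=> bf; rewrite RintegralZl//; exact: bm_integrable. Qed.

Lemma Rintegral_bm_sum (I : Type) (s : seq I) (F : I -> T -> R) :
  (forall i, bm (F i)) ->
  E (fun w => \sum_(i <- s) F i w) = \sum_(i <- s) E (F i).
Proof.
move=> bF; elim: s => [|i s IH].
  rewrite big_nil; under eq_Rintegral do rewrite big_nil.
  by rewrite Rintegral_cst// mul0r.
rewrite big_cons -IH -Rintegral_bmD//; last exact: bm_sum.
by apply: eq_Rintegral => w _; rewrite big_cons.
Qed.

Lemma bounded_convergence (f_ : nat -> T -> R) (f : T -> R) (M : R) :
  (forall n, measurable_fun [set: T] (f_ n)) -> measurable_fun [set: T] f ->
  (forall n w, `|f_ n w| <= M) ->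
  {ae P, forall w, f_ ^~ w @ \oo --> f w} ->
  E (f_ n) @[n --> \oo] --> E f.
Proof.
move=> mf_ mf f_M cf.
have [|||||intf _ cvgE] := @dominated_convergence _ _ _ P setT measurableT
  (fun n => EFin \o f_ n) (EFin \o f) (cst M%:E).
- by move=> n; exact/measurable_EFinP.
- exact/measurable_EFinP.
- by apply: filterS cf => w cw _; apply: cvg_EFin => //; exact: nearW.
- by apply: (bounded_integrable (M := `|M|)).
- by apply: aeW => w n _ /=; rewrite lee_fin.
by apply/fine_cvg; rewrite fineK//; exact: integrable_fin_num.
Qed.

(** * Almost everywhere convergence of averages of bits with constant pair correlation *)

Section BlockAverages.
Variables (b : nat -> T -> R) (p q : R).
Hypothesis mb : forall k, measurable_fun [set: T] (b k).
Hypothesis b01 : forall k w, b k w = 0 \/ b k w = 1.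
Hypothesis Ebb : forall k l, k != l -> E (fun w => b k w * b l w) = q.
Hypothesis Eb2 : forall k, E (fun w => b k w * b k w) = p.

(** The blocks of indices [4^j, 2 4^j[ are pairwise disjoint, so products of different averages only
    involve distinct bits; their size 4^j makes successive averages differ by O(2^-j) in L^2, which
    is summable. *)
Definition block_avg j w := (4 ^ j)%:R^-1 * \sum_(k < 4 ^ j) b (4 ^ j + k) w.
Local Notation Z := block_avg.

Let bmb k : bm (b k).
Proof.
split=> //; exists 1 => w.
by case: (b01 k w) => ->; rewrite ?normr0 ?normr1 ?lexx ?ler01.
Qed.

Let pow4_gt0 j : 0 < (4 ^ j)%:R :> R.
Proof. by rewrite ltr0n expn_gt0. Qed.

Lemma bm_block_avg j : bm (Z j).
Proof. by apply: bmM; [exact: bm_cst|exact: bm_sum]. Qed.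

Lemma block_avg_itv j w : 0 <= Z j w <= 1.
Proof.
have b_itv k : 0 <= b k w <= 1.
  by case: (b01 k w) => ->; rewrite ?lexx ?ler01.
apply/andP; split.
  rewrite mulr_ge0 ?invr_ge0 ?ler0n// sumr_ge0// => k _.
  by have /andP[] := b_itv (4 ^ j + k)%N.
rewrite ler_pdivrMl// mulr1.
rewrite (le_trans (ler_sum _ (G := fun=> 1) _))//.
  by move=> k _; have /andP[] := b_itv (4 ^ j + k)%N.
by rewrite sumr_const card_ord.
Qed.

Let EZZ i j : E (fun w => Z i w * Z j w) =
  (4 ^ i)%:R^-1 * (4 ^ j)%:R^-1 *
  \sum_(k < 4 ^ i) \sum_(l < 4 ^ j) E (fun w => b (4 ^ i + k) w * b (4 ^ j + l) w).
Proof.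
have inner (k : nat) : \sum_(l < 4 ^ j) E (fun w => b k w * b (4 ^ j + l) w) =
    E (fun w => \sum_(l < 4 ^ j) b k w * b (4 ^ j + l) w).
  by rewrite Rintegral_bm_sum// => l; exact: bmM.
under eq_bigr do rewrite inner.
rewrite -(@Rintegral_bm_sum _ _ (fun k w =>
    \sum_(l < 4 ^ j) b (4 ^ i + nat_of_ord k) w * b (4 ^ j + l) w)); last first.
  by move=> k; apply: bm_sum => l; exact: bmM.
rewrite -Rintegral_bmZ; last first.
  by apply: bm_sum => k; apply: bm_sum => l; exact: bmM.
apply: eq_Rintegral => w _; rewrite /Z mulrACA; congr (_ * _).
by rewrite mulr_suml; apply: eq_bigr => k _; rewrite mulr_sumr.
Qed.

(** Of the 16^i pairs of indices, the 4^i diagonal ones contribute p and the others q. *)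
Let EZ2 i : E (fun w => Z i w * Z i w) = q + (p - q) / (4 ^ i)%:R.
Proof.
rewrite EZZ.
under eq_bigr => k _.
  rewrite (bigD1 k)//= Eb2.
  under eq_bigr => l lk.
    rewrite Ebb; last by rewrite eqn_add2l eq_sym.
    over.
  rewrite sumr_const cardC1 card_ord -subn1.
  over.
have i0 := pow4_gt0 i.
rewrite sumr_const card_ord -mulr_natl -[q *+ _]mulr_natl natrB ?expn_gt0//.
by field; rewrite gt_eqF.
Qed.

Let EZZ_neq i j : (i < j)%N -> E (fun w => Z i w * Z j w) = q.
Proof.
move=> ij; rewrite EZZ.
under eq_bigr => k _.
  under eq_bigr => l _.
    rewrite Ebb; last first.
      (* Disjointness of blocks: 4^i + k < 2 4^i <= 4^(i+1) <= 4^j. *)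
      rewrite neq_ltn; apply/orP; left.
      rewrite (@leq_trans (4 ^ j))// ?leq_addr//.
      rewrite (@leq_trans (4 ^ i.+1))//; last by rewrite leq_exp2l.
      rewrite expnS -[4%N]/(2 + 2)%N mulnDl.
      rewrite (@leq_trans (4 ^ i + 4 ^ i))// ?ltn_add2l//.
      by rewrite leq_add// leq_pmull.
    over.
  rewrite sumr_const card_ord.
  over.
rewrite sumr_const card_ord -mulr_natl -[q *+ _]mulr_natl.
by field; rewrite !gt_eqF.
Qed.

(** Expanding the square, the terms q cancel and (p - q) (4^-(j+1) + 4^-j) remains. *)
Let ED2 j : E (fun w => (Z j.+1 w - Z j w) ^+ 2) <= 2 * `|p - q| / (4 ^ j)%:R.
Proof.
have bZ := bm_block_avg.
rewrite (_ : E _ = E (fun w => (Z j.+1 w * Z j.+1 w + Z j w * Z j w) +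
                               (- 2) * (Z j w * Z j.+1 w))); last first.
  by apply: eq_Rintegral => w _; ring.
rewrite Rintegral_bmD; first last.
- by apply: bmM; [exact: bm_cst|exact: bmM].
- by apply: bmD; exact: bmM.
rewrite Rintegral_bmD; [|exact: bmM|exact: bmM].
rewrite Rintegral_bmZ; last exact: bmM.
rewrite !EZ2 EZZ_neq//.
rewrite (_ : _ + _ = (p - q) * ((4 ^ j.+1)%:R^-1 + (4 ^ j)%:R^-1)); last by ring.
rewrite (le_trans (ler_norm _))// normrM -mulrA mulrCA ler_wpM2l//.
rewrite ger0_norm; last by rewrite addr_ge0// invr_ge0.
rewrite mulr2n mulrDl mul1r lerD2r lef_pV2 ?posrE// ler_nat.
by rewrite leq_exp2l.
Qed.

(** The inequality |t| <= e + t^2 / e with e = 2^-j turns the quadratic bound into an L^1 bound. The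
    result is written over 2^(j+1) to match the geometric series of [epsilon_trick0]. *)
Let ED j : E (fun w => `|Z j.+1 w - Z j w|) <=
  (2 * (fine (P setT) + 2 * `|p - q|)) / (2 ^ j.+1)%:R.
Proof.
have bZ := bm_block_avg.
have bD : bm (fun w => Z j.+1 w - Z j w) by exact: bmB.
have p2 : 0 < (2 ^ j)%:R :> R by rewrite ltr0n expn_gt0.
have E42 : (4 ^ j)%:R = (2 ^ j)%:R * (2 ^ j)%:R :> R.
  by rewrite -natrM -expnMn.
pose e : R := (2 ^ j)%:R^-1.
have e0 : 0 < e by rewrite invr_gt0.
have amgm (t : R) : `|t| <= e + e^-1 * t ^+ 2.
  rewrite -[leRHS](@mulfK _ e) ?gt_eqF// ler_pdivlMr//.
  rewrite mulrDl mulrAC mulVf ?gt_eqF// mul1r -real_normK ?num_real//.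
  have := sqr_ge0 (`|t| - e); have := sqr_ge0 `|t|; have := normr_ge0 t.
  have := e0; nra.
apply: (@le_trans _ _ (E (fun w => e + e^-1 * (Z j.+1 w - Z j w) ^+ 2))).
  apply: le_Rintegral => //; first by apply: bm_integrable; exact: bm_norm.
  apply: bm_integrable; apply: bmD; first exact: bm_cst.
  by apply: bmM; [exact: bm_cst|exact: bmX].
rewrite Rintegral_bmD; first last.
- by apply: bmM; [exact: bm_cst|exact: bmX].
- exact: bm_cst.
rewrite Rintegral_bmZ; last exact: bmX.
rewrite Rintegral_cst// expnS natrM invfM mulrACA divff// mul1r mulrC mulrDl.
rewrite lerD2l /e invrK (le_trans (ler_wpM2l (ltW p2) (ED2 j)))//.
by rewrite E42 invfM mulrCA !mulrA mulrK ?unitfE ?gt_eqF.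
Qed.

Lemma block_avg_cvg : exists X : T -> R,
  [/\ measurable_fun [set: T] X, forall w, 0 <= X w <= 1 &
      {ae P, forall w, Z ^~ w @ \oo --> X w}].
Proof.
pose D j w := `|Z j.+1 w - Z j w|.
have mD j : measurable_fun [set: T] (EFin \o D j).
  apply/measurable_EFinP; rewrite /D.
  by have [] := bm_norm (bmB (bm_block_avg j.+1) (bm_block_avg j)).
pose F w := (\sum_(0 <= j <oo) (D j w)%:E)%E.
have D0 j w : (0 <= (D j w)%:E)%E by rewrite lee_fin normr_ge0.
have intF : P.-integrable setT F.
  apply/integrableP; split.
    rewrite (_ : F = fun w => (\sum_(j <oo | j \in xpredT) (D j w)%:E)%E).
      apply: (@ge0_emeasurable_sum _ _ _ _ (fun j => EFin \o D j)) => [j w _ _|j _].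
        exact: D0.
      exact: mD.
    by apply/funext => w; apply: eq_eseriesl.
  under eq_integral do rewrite gee0_abs ?nneseries_ge0//.
  rewrite integral_nneseries//.
  apply: (@le_lt_trans _ _ (2 * (fine (P setT) + 2 * `|p - q|))%:E); last exact: ltry.
  apply: (le_trans _ (@epsilon_trick0 R _ xpredT _)); last first.
    by rewrite mulr_ge0// addr_ge0 ?mulr_ge0// fine_ge0.
  apply: lee_nneseries => [j _ _|j _]; first by apply: integral_ge0.
  rewrite -[leLHS]fineK; first by rewrite lee_fin; exact: ED.
  apply: integrable_fin_num => //; apply: bm_integrable; apply: bm_norm.
  exact: bmB (bm_block_avg j.+1) (bm_block_avg j).
(* The sum F of the increments is integrable, hence finite almost everywhere, and there the
   telescoping series of Z converges absolutely. *)
have cvgZ : {ae P, forall w, cvgn (Z ^~ w)}.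
  apply: filterS (integrable_ae measurableT intF) => w /(_ Logic.I) Fw.
  have : cvgn [normed series (telescope (Z ^~ w))].
    apply: nondecreasing_is_cvgn.
      by apply: nondecreasing_series => j _ _ /=.
    exists (fine (F w)) => _ [j _ <-].
    rewrite -lee_fin fineK// /series /= -sumEFin.
    exact: nneseries_lim_ge.
  move/normed_cvg => cs.
  rewrite (_ : Z ^~ w = (fun j => Z 0%N w + series (telescope (Z ^~ w)) j)).
    by apply: is_cvgD => //; exact: is_cvg_cst.
  by apply/funext => j; rewrite -(eq_sum_telescope (Z ^~ w)).
(* Clamping the upper limit gives a function that is measurable and in [0, 1] everywhere, also where
   Z diverges; where Z converges, the clamp changes nothing. *)
exists (fun w => Num.max 0 (Num.min 1 (limn_sup (Z ^~ w)))); split.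
- apply: measurable_maxr => //; apply: measurable_minr => //.
  apply: measurable_fun_limn_sup => [w _|w _|j].
  + by exists 1 => _ [j _ <-]; have /andP[] := block_avg_itv j w.
  + by exists 0 => _ [j _ <-]; have /andP[] := block_avg_itv j w.
  + by have [] := bm_block_avg j.
- move=> w; rewrite le_max lexx /= ge_max ler01 /= ge_min lexx //.
- apply: filterS cvgZ => w cw.
  have /cvg_ex[l Zl] := cw.
  have -> : limn_sup (Z ^~ w) = l by apply/cvg_lim => //; apply: cvg_sups.
  have l01 : 0 <= l <= 1.
    rewrite -(cvg_lim (@Rhausdorff R) Zl); apply/andP; split.
      by apply: limr_ge => //; apply: nearW => j; have /andP[] := block_avg_itv j w.
    by apply: limr_le => //; apply: nearW => j; have /andP[] := block_avg_itv j w.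
  by case/andP: l01 => l0 l1; rewrite (min_idPr _)// (max_idPr _).
Qed.

End BlockAverages.
End BoundedMeasurable.

(* De Finetti: the block averages of the bits attached to y i converge to a
   random variable X i, and the X i have the joint moments prescribed by L. *)
Lemma variables_of_functional (R : realType) (A : comAlgType R)
    (L : {scalar A}) (C : A -> Prop) (m : nat) (y : 'I_m.+1 -> A) :
  (forall g, C g -> 0 <= L g) ->
  (forall g i, C g -> C (g * y i)) ->
  (forall g i, C g -> C (g * (1 - y i))) -> C 1 ->
  exists (P : {measure set (measurableTypeR R) -> \bar R})
         (X : 'I_m.+1 -> R -> R),
  [/\ (P setT < +oo)%E,
      forall i, measurable_fun [set: measurableTypeR R] (X i),
      forall i w, 0 <= X i w <= 1 &
      forall l : seq 'I_m.+1,
        \int[P]_w \prod_(i <- l) X i w = L (\prod_(i <- l) y i)].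
Proof.
move=> C0 CM CM1 C1.
(* The sequence runs through the y i cyclically, so each y i owns infinitely many bits: [pos i k] is
   the index of its k-th one. *)
pose x (k : nat) : A := y (inord (k %% m.+1)).
have [P [B [finP mB B01 EB]]] :=
  bits_of_functional C0 (fun g k => CM g _) (fun g k => CM1 g _) C1 (x := x).
pose pos (i : 'I_m.+1) (k : nat) := (k * m.+1 + i)%N.
have x_pos i k : x (pos i k) = y i.
  by rewrite /x /pos modnMDl modn_small// inord_val.
have pos_inj i : injective (pos i).
  by move=> j k /eqP; rewrite eqn_add2r eqn_pmul2r// => /eqP.
have le_pos i k : (k <= pos i k)%N.
  by rewrite /pos (leq_trans _ (leq_addr _ _))// leq_pmulr.
have bmB k : bounded_measurable (B k : measurableTypeR R -> R).
  split=> //; exists 1 => w.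
  by case: (B01 k w) => ->; rewrite ?normr0 ?normr1 ?lexx ?ler01.
have Ebb i k l : k != l ->
    \int[P]_w (B (pos i k) w * B (pos i l) w) = L (y i * y i).
  move=> kl; have := EB [:: pos i k; pos i l].
  rewrite /= inE (inj_eq (pos_inj i)) kl => /(_ isT).
  rewrite !big_cons big_nil mulr1 !x_pos => <-.
  by apply: eq_Rintegral => w _; rewrite !big_cons big_nil mulr1.
have Eb2 i k : \int[P]_w (B (pos i k) w * B (pos i k) w) = L (y i).
  have := EB [:: pos i k] isT; rewrite big_seq1 x_pos => <-.
  apply: eq_Rintegral => w _; rewrite big_seq1.
  by case: (B01 (pos i k) w) => ->; rewrite ?mul0r ?mul1r.
have /choice[X hX] : forall i, exists X : R -> R,
    [/\ measurable_fun [set: measurableTypeR R] X, forall w, 0 <= X w <= 1 &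
      {ae P, forall w, (fun j => block_avg (fun k => B (pos i k)) j w) @ \oo --> X w}].
  move=> i; apply: (@block_avg_cvg _ _ _ _ finP _ (L (y i)) (L (y i * y i))).
  - by move=> k; exact: mB.
  - by move=> k w; exact: B01.
  - exact: Ebb.
  - exact: Eb2.
have mX i := let: And3 h _ _ := hX i in h.
have X01 i := let: And3 _ h _ := hX i in h.
have cX i := let: And3 _ _ h := hX i in h.
exists P, X; split=> // l.
have normX i w : `|X i w| <= 1.
  by have /andP[X0 X1] := X01 i w; rewrite ger0_norm.
have bmX i : bounded_measurable (X i : measurableTypeR R -> R).
  by split; [exact: mX|exists 1 => w].
(* The factors X i are replaced one at a time by averages of bits. The bits so produced must coexist
   with those produced earlier, hence the additional product over an arbitrary S. *)
suff H (S : seq nat) : uniq S ->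
    \int[P]_w (\prod_(k <- S) B k w * \prod_(i <- l) X i w) =
    L (\prod_(k <- S) x k * \prod_(i <- l) y i).
  have := H [::] isT; rewrite big_nil mul1r => <-.
  by apply: eq_Rintegral => w _; rewrite big_nil mul1r.
elim: l S => [|i l IH] S uS.
  rewrite big_nil mulr1 -EB//.
  by apply: eq_Rintegral => w _; rewrite big_nil mulr1.
pose Z := block_avg (fun k => B (pos i k)).
pose G w := \prod_(k <- S) B k w * \prod_(i <- l) X i w.
have bmG : bounded_measurable (G : measurableTypeR R -> R).
  by apply: bmM; exact: bm_prod.
have normG w : `|G w| <= 1.
  rewrite /G normrM mulr_ile1// normr_prod; apply: prodr_ile1 => k _; rewrite normr_ge0 /=.
    by case: (B01 k w) => ->; rewrite ?normr0 ?normr1 ?lexx ?ler01.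
  exact: normX.
have bmZ j : bounded_measurable (Z j : measurableTypeR R -> R).
  by apply: bm_block_avg => // k; exact: B01.
have cvgE : \int[P]_w (Z j w * G w) @[j --> \oo] --> \int[P]_w (X i w * G w).
  apply: (@bounded_convergence _ _ _ _ finP _ _ 1).
  - by move=> j; have [] := bmM (bmZ j) bmG.
  - by have [] := bmM (bmX i) bmG.
  - move=> j w; rewrite normrM mulr_ile1//.
    have /andP[Z0 Z1] := block_avg_itv (fun k w => B01 (pos i k) w) j w.
    by rewrite ger0_norm.
  - by apply: (@filterS _ _ (ae_filter_ringOfSetsType P) _ _ _ (cX i)) => w cw; apply: cvgMl.
(* For j >= M all bits of the block have indices at least 4^j > j >= M, so they are not in S: each
   can be added to S, and the integral no longer depends on j. *)
pose M := (\max_(k <- S) k).+1.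
have EZ j : (M <= j)%N -> \int[P]_w (Z j w * G w) =
    L (\prod_(k <- S) x k * \prod_(i <- i :: l) y i).
  move=> Mj.
  rewrite (_ : Rintegral _ _ _ = \int[P]_w ((4 ^ j)%:R^-1 *
      \sum_(k < 4 ^ j) (B (pos i (4 ^ j + k)%N) w * G w))); last first.
    by apply: eq_Rintegral => w _; rewrite /Z /block_avg -mulrA mulr_suml.
  rewrite Rintegral_bmZ//; last by apply: bm_sum => k; exact: bmM.
  rewrite (_ : Rintegral _ _ _ = \sum_(k < 4 ^ j)
      \int[P]_w (B (pos i (4 ^ j + k)%N) w * G w)); last first.
    by apply: Rintegral_bm_sum => // k; exact: bmM.
  rewrite (eq_bigr (fun=> L (\prod_(k <- S) x k * \prod_(i <- i :: l) y i))).
    rewrite sumr_const card_ord -[X in _ * X]mulr_natl mulKf//.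
  move=> k _; pose k' := pos i (4 ^ j + k)%N.
  have k'S : k' \notin S.
    apply/negP => k'S; have : (k' < M)%N by rewrite ltnS; exact: leq_bigmax_seq.
    rewrite ltnNge => /negP; apply; rewrite (leq_trans Mj)//.
    rewrite (leq_trans _ (le_pos i _))// (leq_trans _ (leq_addr _ _))//.
    by rewrite ltnW// ltn_expl.
  have := IH (k' :: S); rewrite /= k'S => /(_ uS).
  rewrite !big_cons x_pos mulrA [_ * y i]mulrC => <-.
  by apply: eq_Rintegral => w _; rewrite big_cons /G mulrA.
transitivity (\int[P]_w (X i w * G w)).
  by apply: eq_Rintegral => w _; rewrite big_cons /G mulrCA.
rewrite -(cvg_lim (@Rhausdorff R) cvgE).
apply/cvg_lim => //; apply: cvg_near_cst.
by exists M => // j /= Mj; exact: EZ.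
Qed.

(** * Sums of squares modulo the relation s (1 + |t|^2) = 1 *)

Section SumsOfSquares.
Context (R : realType) (A : comAlgType R).

Inductive sos : A -> Prop :=
| sos0 : sos 0
| sos_cons a p : sos p -> sos (a * a + p).

Lemma sos_sqr a : sos (a * a).
Proof. by rewrite -[a * a]addr0; apply: sos_cons; exact: sos0. Qed.

Lemma sosD p q : sos p -> sos q -> sos (p + q).
Proof.
by move=> sp sq; elim: sp => [|a p' _ IH]; rewrite ?add0r// -addrA; apply: sos_cons.
Qed.

Lemma sosM p q : sos p -> sos q -> sos (p * q).
Proof.
move=> sp sq; elim: sp => [|a p' _ IH]; first by rewrite mul0r; exact: sos0.
rewrite mulrDl; apply: sosD => //.
elim: sq => [|b q' _ IHq]; first by rewrite mulr0; exact: sos0.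
by rewrite mulrDr mulrACA; exact: sos_cons.
Qed.

Lemma sos_sum (I : Type) (r : seq I) (Q : pred I) (F : I -> A) :
  (forall i, sos (F i)) -> sos (\sum_(i <- r | Q i) F i).
Proof. by move=> sF; apply: big_ind => //; [exact: sos0|exact: sosD]. Qed.

Lemma sos_cst (c : R) : 0 <= c -> sos c%:A.
Proof.
move=> c0; rewrite (_ : c%:A = (Num.sqrt c)%:A * (Num.sqrt c)%:A); first exact: sos_sqr.
by rewrite -scalerAl mul1r scalerA -expr2 sqr_sqrtr.
Qed.

Variable L : {scalar A}.
Hypothesis L_sqr : forall a, 0 <= L (a * a).

Lemma sos_ge0 p : sos p -> 0 <= L p.
Proof.
by elim=> [|a q _ IH]; rewrite ?linear0// linearD addr_ge0.
Qed.

(* Congruence modulo the largest ideal contained in the kernel of L. *)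
Definition eqL (a b : A) := forall c, L (c * a) = L (c * b).

Lemma eqL_sym a b : eqL a b -> eqL b a. Proof. by move=> ab c; rewrite ab. Qed.

Lemma eqL_trans b a c : eqL a b -> eqL b c -> eqL a c.
Proof. by move=> ab bc d; rewrite ab. Qed.

Lemma eqLD a b c d : eqL a b -> eqL c d -> eqL (a + c) (b + d).
Proof. by move=> ab cd e; rewrite !mulrDr !linearD ab cd. Qed.

Lemma eqLM a b c d : eqL a b -> eqL c d -> eqL (a * c) (b * d).
Proof. by move=> ab cd e; rewrite mulrA cd mulrAC ab mulrAC mulrA. Qed.

Lemma eqLE a b : eqL a b -> L a = L b.
Proof. by move=> ab; have := ab 1; rewrite !mul1r. Qed.

(** A product of sums of squares is again one, so this cone is closed under products as well as
    sums; it is the cone fed to the construction of random bits. *)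
Definition pos (p : A) := exists2 q, sos q & eqL p q.

Lemma sos_pos p : sos p -> pos p. Proof. by exists p. Qed.

Lemma posD p q : pos p -> pos q -> pos (p + q).
Proof.
move=> [p' sp pp'] [q' sq qq']; exists (p' + q'); first exact: sosD.
exact: eqLD.
Qed.

Lemma posM p q : pos p -> pos q -> pos (p * q).
Proof.
move=> [p' sp pp'] [q' sq qq']; exists (p' * q'); first exact: sosM.
exact: eqLM.
Qed.

Lemma pos_eqL p q : eqL p q -> pos q -> pos p.
Proof. by move=> pq [r sr qr]; exists r => //; exact: eqL_trans qr. Qed.

Lemma pos_ge0 p : pos p -> 0 <= L p.
Proof. by move=> [q sq /eqLE ->]; exact: sos_ge0. Qed.

Lemma pos1 : pos 1.
Proof. by apply: sos_pos; rewrite -[1]mulr1; exact: sos_sqr. Qed.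

Lemma posX p k : pos p -> pos (p ^+ k).
Proof.
by move=> pp; elim: k => [|k IH]; rewrite ?expr0 ?exprS; [exact: pos1|exact: posM].
Qed.

Lemma posMn p k : pos p -> pos (p *+ k).
Proof.
move=> pp; elim: k => [|k IH]; first by rewrite mulr0n; apply: sos_pos; exact: sos0.
by rewrite mulrS; exact: posD.
Qed.

Variables (n : nat) (t : 'I_n -> A) (s : A).
Let theta := 1 + \sum_j t j * t j.
Hypothesis L_theta : forall a, L (a * (s * theta)) = L a.

Let s_theta : eqL (s * theta) 1.
Proof. by move=> c; rewrite L_theta mulr1. Qed.

Let sos_theta : sos theta.
Proof.
by rewrite /theta -{1}[1]mulr1; apply: sos_cons; apply: sos_sum => j; exact: sos_sqr.
Qed.

(** Inserting the factor s theta = 1 turns s into s^2 theta. *)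
Lemma pos_s : pos s.
Proof.
apply: (@pos_eqL _ (s * s * theta)).
  rewrite -mulrA -{1}[s]mulr1; apply: eqLM => //; exact: eqL_sym.
by apply: posM; apply: sos_pos => //; exact: sos_sqr.
Qed.

(** Here 1 is replaced by s theta, which leaves s times the sum of the t_j^2. *)
Lemma pos_1Bs : pos (1 - s).
Proof.
apply: (@pos_eqL _ (s * \sum_j t j * t j)).
  rewrite (_ : s * _ = s * theta - s); last by rewrite /theta mulrDr mulr1 addrAC subrr add0r.
  by apply: eqLD => //; exact: eqL_sym.
apply: posM; first exact: pos_s.
by apply/sos_pos/sos_sum => j; exact: sos_sqr.
Qed.

(* s (theta + 2 e t_j) = s ((1 + e t_j)^2 + \sum_(k != j) t_k^2) *)
Lemma pos_half_ts (e : A) j : e * e = 1 -> pos ((2^-1)%:A + e * (t j * s)).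
Proof.
move=> e2; set h : A := (2^-1)%:A.
have h2 : h + h = 1 by rewrite -scalerDl -[RHS]scale1r; congr (_ *: _); lra.
pose sq := (1 + e * t j) * (1 + e * t j) + \sum_(k | k != j) t k * t k.
have sqE : sq = theta + (e * t j + e * t j).
  have ett : t j * t j = e * t j * (e * t j) by rewrite mulrACA e2 mul1r.
  by rewrite /theta (bigD1 j)//= ett /sq; ring.
apply: (@pos_eqL _ (h * (s * sq))); last first.
  apply: posM; first by apply/sos_pos/sos_cst; lra.
  apply: posM; first exact: pos_s.
  by apply/sos_pos/sos_cons/sos_sum => k; exact: sos_sqr.
rewrite (_ : h * (s * sq) = h * (s * theta) + (h + h) * (e * (t j * s))); last first.
  by rewrite sqE; ring.
rewrite h2 mul1r; apply: eqLD => //.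
by rewrite -{1}[h]mulr1; apply: eqLM => //; exact: eqL_sym.
Qed.

(** 1 - (1 - s)^N is the sum of the s (1 - s)^k for k < N, each of which dominates s (1 - s)^N. In
    the induction, passing from N to N + 1 adds (N + 1) s^2 (1 - s)^N. *)
Lemma pos_1B_cut N : pos (1 - (1 - s) ^+ N - (s * (1 - s) ^+ N) *+ N).
Proof.
elim: N => [|N IH].
  by rewrite expr0 subrr mulr0n subr0; apply: sos_pos; exact: sos0.
rewrite (_ : _ - _ = (1 - (1 - s) ^+ N - (s * (1 - s) ^+ N) *+ N) +
    (s * s * (1 - s) ^+ N) *+ N.+1); last by rewrite exprS; ring.
apply: posD => //; apply: posMn; apply: posM; first by apply: sos_pos; exact: sos_sqr.
by apply: posX; exact: pos_1Bs.
Qed.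

(** Inserting s theta turns f (1 - s)^N into f theta s (1 - s)^N, and N s (1 - s)^N <= 1 by
    [pos_1B_cut]. *)
Lemma L_cut_le f N : pos f -> L (f * (1 - s) ^+ N) *+ N <= L (f * theta).
Proof.
move=> pf; rewrite -subr_ge0.
have -> : L (f * (1 - s) ^+ N) = L (f * theta * (s * (1 - s) ^+ N)).
  by rewrite -(L_theta (f * _)); congr (L _); ring.
rewrite -raddfMn -raddfB; apply: pos_ge0.
rewrite (_ : _ - _ = f * theta * ((1 - s) ^+ N +
    (1 - (1 - s) ^+ N - (s * (1 - s) ^+ N) *+ N))); last by ring.
apply: posM; first by apply: posM => //; exact: sos_pos.
by apply: posD; [apply: posX; exact: pos_1Bs|exact: pos_1B_cut].
Qed.

Lemma pos_1B_expr u r : pos u -> pos (1 - u) -> pos (1 - u ^+ r).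
Proof.
move=> pu pu1; elim: r => [|r IH].
  by rewrite expr0 subrr; apply: sos_pos; exact: sos0.
rewrite (_ : 1 - _ = (1 - u) + u * (1 - u ^+ r)); last by rewrite exprS; ring.
by apply: posD => //; exact: posM.
Qed.

Lemma pos_1B_cutX N : pos (1 - (1 - s) ^+ N).
Proof.
have p1s := pos_1Bs; apply: pos_1B_expr => //.
by rewrite opprB addrC subrK; exact: pos_s.
Qed.

(** Bernoulli's inequality 1 - (1 - u)^r <= r u, weighted by f. *)
Lemma L_1B_expr_le f u r : pos f -> pos u -> pos (1 - u) ->
  L (f * (1 - (1 - u) ^+ r)) <= L (f * u) *+ r.
Proof.
move=> pf pu pu1; elim: r => [|r IH].
  by rewrite expr0 subrr mulr0 raddf0 mulr0n.
rewrite mulrS; apply: (@le_trans _ _ (L (f * u) + L (f * (1 - (1 - u) ^+ r)))).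
  rewrite -raddfD -subr_ge0 -raddfB.
  rewrite (_ : _ - _ = f * u * (1 - (1 - u) ^+ r)); last by rewrite exprS; ring.
  apply: pos_ge0; apply: posM; first exact: posM.
  by apply: pos_1B_expr => //; rewrite opprB addrC subrK.
by rewrite lerD2l.
Qed.

(** Bernoulli with u = (1 - s)^(N+1), followed by [L_cut_le], bounds the defect by r L (f theta) /
    (N + 1). This identifies the limits in the monotone convergence argument. *)
Lemma L_cut_cvg f r : pos f ->
  L (f * (1 - (1 - s) ^+ N) ^+ r) @[N --> \oo] --> L f.
Proof.
move=> pf; have p1s := pos_1Bs.
pose K := L (f * theta) *+ r.
have K0 : 0 <= K.
  by apply: mulrn_wge0; apply: pos_ge0; apply: posM => //; exact: sos_pos.
have bnd N : L f - K / N.+1%:R <= L (f * (1 - (1 - s) ^+ N.+1) ^+ r) <= L f.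
  have pc := pos_1B_cutX N.+1.
  have pv : pos ((1 - s) ^+ N.+1) by exact: posX.
  apply/andP; split.
    rewrite lerBlDl -lerBlDr -raddfB.
    rewrite -{1}[f]mulr1 -mulrBr (le_trans (L_1B_expr_le _ pf pv pc))//.
    rewrite ler_pdivlMr// mulr_natr -mulrnA mulnC mulrnA.
    by apply: ler_wMn2r; exact: L_cut_le.
  rewrite -subr_ge0 -raddfB -{1}[f]mulr1 -mulrBr; apply: pos_ge0.
  by apply: posM => //; apply: pos_1B_expr => //; rewrite opprB addrC subrK.
rewrite -(cvg_shiftS (fun N => L (f * (1 - (1 - s) ^+ N) ^+ r))).
apply: (@squeeze_cvgr _ _ _ _ (fun N => L f - K / N.+1%:R) (fun=> L f)).
- by apply: nearW => N; exact: bnd.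
- rewrite -[X in _ --> X]subr0 -[in X in _ --> X](mulr0 K).
  apply: cvgB; first exact: cvg_cst.
  by apply: cvgMr; exact: cvg_harmonic.
- exact: cvg_cst.
Qed.

End SumsOfSquares.

(** * Representation of the functional on the real line *)

Lemma measurable_funV d (T : measurableType d) (R : realType) (f : T -> R) :
  (forall x, 0 <= f x) -> measurable_fun [set: T] f ->
  measurable_fun [set: T] (fun x => (f x)^-1).
Proof.
move=> f0 mf; under eq_fun => x do rewrite -powR_inv1//.
exact: measurableT_comp (measurable_powR _) mf.
Qed.

Section AlgebraPairs.
Context (R : realType) (A : comAlgType R) (T I : Type).
Variables (X : I -> T -> R) (y : I -> A).

(* (F, f) is the evaluation at X and at y of a common polynomial. *)
Inductive alg_pair : (T -> R) -> A -> Prop :=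
| alg_pair_gen i : alg_pair (X i) (y i)
| alg_pair_cst c : alg_pair (fun=> c) c%:A
| alg_pairD F f G g : alg_pair F f -> alg_pair G g ->
    alg_pair (fun w => F w + G w) (f + g)
| alg_pairM F f G g : alg_pair F f -> alg_pair G g ->
    alg_pair (fun w => F w * G w) (f * g).

Lemma alg_pair1 : alg_pair (fun=> 1) 1.
Proof. by rewrite -[X in alg_pair _ X]scale1r; exact: alg_pair_cst. Qed.

Lemma alg_pairX F f k : alg_pair F f -> alg_pair (fun w => F w ^+ k) (f ^+ k).
Proof.
move=> Ff; elim: k => [|k IH]; first exact: alg_pair1.
rewrite exprS (_ : (fun _ => _) = fun w => F w * F w ^+ k); first exact: alg_pairM.
by apply/funext => w; rewrite exprS.
Qed.

Lemma alg_pairZ c F f : alg_pair F f -> alg_pair (fun w => c * F w) (c *: f).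
Proof.
move=> Ff; rewrite -[f]mul1r scalerAl.
by apply: alg_pairM => //; exact: alg_pair_cst.
Qed.

Lemma alg_pairB F f G g : alg_pair F f -> alg_pair G g ->
  alg_pair (fun w => F w - G w) (f - g).
Proof.
move=> Ff Gg; rewrite -scaleN1r (_ : (fun _ => _) = fun w => F w + (-1) * G w).
  by apply: alg_pairD => //; exact: alg_pairZ.
by apply/funext => w; rewrite mulN1r.
Qed.

Lemma alg_pair_sum (J : Type) (r : seq J) F f :
  (forall j, alg_pair (F j) (f j)) ->
  alg_pair (fun w => \sum_(j <- r) F j w) (\sum_(j <- r) f j).
Proof.
move=> Ff; elim: r => [|j r IH].
  rewrite big_nil (_ : (fun _ => _) = fun=> 0).
    by rewrite -[X in alg_pair _ X](scale0r 1); exact: alg_pair_cst.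
  by apply/funext => w; rewrite big_nil.
rewrite big_cons (_ : (fun _ => _) = fun w => F j w + \sum_(j <- r) F j w).
  exact: alg_pairD.
by apply/funext => w; rewrite big_cons.
Qed.

Lemma alg_pair_prod (J : Type) (r : seq J) F f :
  (forall j, alg_pair (F j) (f j)) ->
  alg_pair (fun w => \prod_(j <- r) F j w) (\prod_(j <- r) f j).
Proof.
move=> Ff; elim: r => [|j r IH].
  rewrite big_nil (_ : (fun _ => _) = fun=> 1); first exact: alg_pair1.
  by apply/funext => w; rewrite big_nil.
rewrite big_cons (_ : (fun _ => _) = fun w => F j w * \prod_(j <- r) F j w).
  exact: alg_pairM.
by apply/funext => w; rewrite big_cons.
Qed.

End AlgebraPairs.

Lemma alg_pair_moment d (T : measurableType d) (R : realType)
    (P : {measure set T -> \bar R}) (A : comAlgType R) (L : {scalar A})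
    (I : Type) (X : I -> T -> R) (y : I -> A) :
  (P setT < +oo)%E -> (forall i, bounded_measurable (X i)) ->
  (forall l, \int[P]_w \prod_(i <- l) X i w = L (\prod_(i <- l) y i)) ->
  forall F f, alg_pair X y F f -> bounded_measurable F /\ \int[P]_w F w = L f.
Proof.
move=> finP bmX EX.
(* The integral of a product is not determined by those of its factors. The induction therefore
   shows that multiplication by (F, f) preserves agreement against all monomials in X. *)
pose H G g := bounded_measurable G /\ forall l,
  \int[P]_w (G w * \prod_(i <- l) X i w) = L (g * \prod_(i <- l) y i).
have bmp l : bounded_measurable (fun w => \prod_(i <- l) X i w).
  exact: bm_prod.
suff HM F f : alg_pair X y F f -> forall G g, H G g -> H (fun w => F w * G w) (f * g).
  move=> F f Ff; have [] := HM _ _ Ff (fun=> 1) 1.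
    split=> [|l]; first exact: bm_cst.
    by rewrite mul1r -EX; apply: eq_Rintegral => w _; rewrite mul1r.
  rewrite (_ : (fun _ => _) = F); last by apply/funext => w; rewrite mulr1.
  move=> bF /(_ [::]); rewrite big_nil !mulr1 => <-; split=> //.
  by apply: eq_Rintegral => w _; rewrite big_nil !mulr1.
elim=> {F f} [i|c|F1 f1 F2 f2 _ IH1 _ IH2|F1 f1 F2 f2 _ IH1 _ IH2] G g HG.
- have [bG EG] := HG; split=> [|l]; first exact: bmM.
  transitivity (L (g * \prod_(i <- i :: l) y i)); last by rewrite big_cons mulrCA mulrA.
  rewrite -EG.
  by apply: eq_Rintegral => w _; rewrite big_cons mulrCA mulrA.
- have [bG EG] := HG; split=> [|l]; first by apply: bmM => //; exact: bm_cst.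
  rewrite -!scalerAl mul1r linearZ /= -EG -Rintegral_bmZ//; last exact: bmM.
  by apply: eq_Rintegral => w _; rewrite mulrA.
- have [b1 E1] := IH1 _ _ HG; have [b2 E2] := IH2 _ _ HG; split=> [|l].
    under eq_fun do rewrite mulrDl; exact: bmD.
  rewrite !mulrDl linearD /= -E1 -E2 -Rintegral_bmD//; [|exact: bmM|exact: bmM].
  by apply: eq_Rintegral => w _; rewrite !mulrDl.
- have [b12 E12] := IH1 _ _ (IH2 _ _ HG).
  under eq_fun do rewrite -mulrA.
  split=> // l; rewrite -[f1 * f2 * g]mulrA -E12.
  by apply: eq_Rintegral => w _.
Qed.

Section Representation.
Context (R : realType) (A : comAlgType R) (L : {scalar A}).
Hypothesis L_sqr : forall a, 0 <= L (a * a).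
Variables (n : nat) (t : 'I_n -> A) (s : A).
Hypothesis L_theta : forall a, L (a * (s * (1 + \sum_j t j * t j))) = L a.

Let y (i : 'I_n.+1) : A :=
  if unlift ord_max i is Some j then (2^-1)%:A + t j * s else s.

Let pos_y i : pos L (y i).
Proof.
rewrite /y; case: unliftP => [j _|_]; last exact: pos_s L_theta.
by rewrite -[t j * s]mul1r; apply: (pos_half_ts L_theta); rewrite mulr1.
Qed.

Let pos_1By i : pos L (1 - y i).
Proof.
rewrite /y; case: unliftP => [j _|_]; last exact: pos_1Bs L_theta.
rewrite (_ : 1 - _ = (2^-1)%:A + (-1) * (t j * s)).
  by apply: (pos_half_ts L_theta); rewrite mulrNN mulr1.
rewrite opprD addrA mulN1r; congr (_ - _).
apply/eqP; rewrite subr_eq -scalerDl (_ : 2^-1 + 2^-1 = 1) ?scale1r//.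
by lra.
Qed.

(** * From the bounded variables back to unbounded ones *)

Section Gluing.
Variables (P : {measure set (measurableTypeR R) -> \bar R}) (X : 'I_n.+1 -> R -> R).
Hypothesis finP : (P setT < +oo)%E.
Hypothesis mX : forall i, measurable_fun [set: measurableTypeR R] (X i).
Hypothesis X01 : forall i w, 0 <= X i w <= 1.
Hypothesis EX : forall l : seq 'I_n.+1,
  \int[P]_w \prod_(i <- l) X i w = L (\prod_(i <- l) y i).

Let S := X ord_max.
Let U (j : 'I_n) w := X (lift ord_max j) w - 2^-1.

Let bmX i : bounded_measurable (X i : measurableTypeR R -> R).
Proof.
split; first exact: mX.
by exists 1 => w; have /andP[X0 X1] := X01 i w; rewrite ger0_norm.
Qed.

Let momentX F f (Ff : alg_pair X y F f) := alg_pair_moment finP bmX EX Ff.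

Let pairS : alg_pair X y S s.
Proof.
rewrite (_ : s = y ord_max); first exact: alg_pair_gen.
by rewrite /y unlift_none.
Qed.

Let pairU j : alg_pair X y (U j) (t j * s).
Proof.
rewrite (_ : t j * s = y (lift ord_max j) - (2^-1)%:A).
  by apply: alg_pairB; [exact: alg_pair_gen|exact: alg_pair_cst].
by rewrite /y liftK addrC addKr.
Qed.

Let pair_cut N : alg_pair X y (fun w => (1 - S w) ^+ N) ((1 - s) ^+ N).
Proof.
by apply: alg_pairX; apply: alg_pairB => //; exact: alg_pair1.
Qed.

Let measurable_S0 : measurable ([set w | S w = 0] : set (measurableTypeR R)).
Proof.
by have := mX ord_max measurableT (measurable_set1 0); rewrite setTI.
Qed.

(* The indicator of S = 0 is below every power of 1 - S. *)
Let P_S_eq0 : P [set w | S w = 0] = 0.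
Proof.
have PS_le N : (P [set w | S w = 0%R] <= (L ((1 - s) ^+ N))%:E)%E.
  have [bmc Ec] := momentX (pair_cut N).
  rewrite -Ec /Rintegral fineK; last by apply: integrable_fin_num => //; exact: bm_integrable.
  rewrite -[X in P X]setIT -integral_indic//.
  apply: ge0_le_integral => //.
  - by apply/measurable_EFinP/measurable_indic.
  - by apply/measurable_EFinP; have [] := bmc.
  move=> w _; rewrite lee_fin indicE; case: (boolP (w \in _)) => /=.
    by rewrite inE /= => ->; rewrite subr0 expr1n.
  by move=> _; rewrite exprn_ge0// subr_ge0; have /andP[] := X01 ord_max w.
have finS : P [set w | S w = 0] \is a fin_num.
  by rewrite ge0_fin_numE//; exact: le_lt_trans (PS_le 0%N) (ltry _).
apply/eqP; rewrite eq_le measure_ge0 andbT -(fineK finS) lee_fin.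
have : L ((1 - s) ^+ N) @[N --> \oo] --> L 1 - L 1.
  rewrite (_ : (fun _ => _) = fun N => L 1 - L (1 * (1 - (1 - s) ^+ N) ^+ 1)).
    apply: cvgB; first exact: cvg_cst.
    by apply: (L_cut_cvg L_sqr L_theta); exact: pos1.
  by apply/funext => N; rewrite expr1 mul1r raddfB /= subKr.
rewrite subrr => cv; rewrite -[leRHS](cvg_lim (@Rhausdorff R) cv).
apply: limr_ge; first exact: cvgP cv.
by apply: nearW => N; rewrite -lee_fin fineK//; exact: PS_le.
Qed.

(** The relation s (s theta) = s rewritten in the bounded variables s and t_j s: the equation of a
    sphere. *)
Let relSU w := S w ^+ 2 + \sum_j U j w ^+ 2 - S w.

Let pair_rel : alg_pair X y relSU (s ^+ 2 + \sum_j (t j * s) ^+ 2 - s).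
Proof.
apply: alg_pairB => //; apply: alg_pairD; first exact: alg_pairX.
by apply: alg_pair_sum => j; exact: alg_pairX.
Qed.

(** The integral of relSU^2 is L (rel rel), where one factor rel = s (s theta) - s is killed by L; a
    square of integral zero vanishes almost everywhere. *)
Let relSU_ae : {ae P, forall w, relSU w = 0}.
Proof.
have [bmr2 E2] := momentX (alg_pairX 2 pair_rel).
have [bmr _] := momentX pair_rel.
have E0 : \int[P]_w (relSU w ^+ 2) = 0.
  rewrite E2 expr2; set rel := (X in X * _); rewrite -/rel.
  have relE : rel = s * (s * (1 + \sum_j t j * t j)) - s.
    rewrite /rel; congr (_ - _); rewrite !mulrDr mulr1 -expr2; congr (_ + _).
    by rewrite !mulr_sumr; apply: eq_bigr => j _; ring.
  by rewrite {2}relE mulrBr (mulrA rel) raddfB /= L_theta subrr.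
have int2 := bm_integrable finP bmr2.
have : ae_eq P setT (EFin \o (fun w => relSU w ^+ 2)) (cst 0%E).
  apply/ae_eq_integral_abs => //; first by apply/measurable_EFinP; have [] := bmr2.
  under eq_integral => w _ do rewrite gee0_abs ?lee_fin ?sqr_ge0//.
  rewrite -[LHS]fineK; first by rewrite [fine _]E0.
  exact: integrable_fin_num.
apply: (@filterS _ _ (ae_filter_ringOfSetsType P)) => w /(_ Logic.I) /= -[] /eqP.
by rewrite sqrf_eq0 => /eqP.
Qed.

Let measurable_relSU0 : measurable ([set w | relSU w = 0] : set (measurableTypeR R)).
Proof.
have [[mr _] _] := momentX pair_rel.
by have := mr measurableT _ (measurable_set1 0); rewrite setTI.
Qed.

Let D : set (measurableTypeR R) := [set w | S w != 0 /\ relSU w = 0].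

Let mD : measurable D.
Proof.
rewrite (_ : D = ~` [set w | S w = 0] `&` [set w | relSU w = 0]).
  by apply: measurableI => //; exact: measurableC.
by apply/seteqP; split => w /= [/eqP].
Qed.

Let PDC : P (~` D) = 0.
Proof.
rewrite (_ : ~` D = [set w | S w = 0] `|` ~` [set w | relSU w = 0]); last first.
  apply/seteqP; split => w /=.
    by move=> /not_andP[/negP/negPn/eqP|]; [left|right].
  by move=> [Sw [/eqP]|rw []].
rewrite null_set_setU//; first exact: measurableC.
by apply/negligibleP => //; exact: measurableC.
Qed.

Let T (j : 'I_n) w := U j w / S w.

(** On D, S^2 (1 + |T|^2) = S^2 + |U|^2 = S, and S can be cancelled. *)
Let DS w : D w -> S w = (1 + \sum_j T j w ^+ 2)^-1.
Proof.
move=> [S0 rw]; apply: invr_inj; rewrite invrK.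
have -> : \sum_j T j w ^+ 2 = (\sum_j U j w ^+ 2) / S w ^+ 2.
  by rewrite mulr_suml; apply: eq_bigr => j _; rewrite expr_div_n.
have -> : \sum_j U j w ^+ 2 = S w - S w ^+ 2.
  by apply/eqP; rewrite -subr_eq0 -[X in _ == X]rw /relSU; apply/eqP; ring.
by field.
Qed.

Let mU j : measurable_fun [set: measurableTypeR R] (U j).
Proof. by have [[mU _] _] := momentX (pairU j). Qed.

Let mT j : measurable_fun [set: measurableTypeR R] (T j).
Proof.
apply: measurable_funM; first exact: mU.
have S0 w : 0 <= S w by have /andP[] := X01 ord_max w.
exact: measurable_funV S0 (mX ord_max).
Qed.
(** A function of T alone, unlike S, with which it agrees on D; thus the law of T will determine the
    integrals of the powers of s. *)
Let theta_inv w := (1 + \sum_j T j w ^+ 2)^-1.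

Let GX (o : option 'I_n) : R -> R := if o is Some j then T j else theta_inv.
Let Gy (o : option 'I_n) : A := if o is Some j then t j else s.

Let mGX o : measurable_fun [set: measurableTypeR R] (GX o).
Proof.
case: o => [j|] /=; first exact: mT.
have theta0 w : 0 <= 1 + \sum_j T j w ^+ 2.
  by rewrite addr_ge0// sumr_ge0// => j _; exact: sqr_ge0.
apply: (measurable_funV theta0); apply: measurable_funD => //; apply: measurable_sum => j.
by apply: measurable_funX; exact: mT.
Qed.

Let mG F f : alg_pair GX Gy F f -> measurable_fun [set: measurableTypeR R] F.
Proof.
by elim=> {F f} [i|c|F f G g _ mF _ mG|F f G g _ mF _ mG];
  [exact: mGX|exact: measurable_cst|exact: measurable_funD|exact: measurable_funM].
Qed.

(** Each T j = U j / S costs one power of S, while [theta_inv] equals S on D and costs none; sums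
    and products add the exponents. *)
Let clear_denom F f : alg_pair GX Gy F f -> exists r H,
  alg_pair X y H (f * s ^+ r) /\ forall w, D w -> F w * S w ^+ r = H w.
Proof.
elim=> {F f} [[j|]|c|F f G g _ [r [H [pH FH]]] _ [q [K [pK GK]]]|
    F f G g _ [r [H [pH FH]]] _ [q [K [pK GK]]]].
- exists 1%N, (U j); split=> [|w [S0 _]]; first by rewrite expr1; exact: pairU.
  by rewrite expr1 /= divfK.
- exists 0%N, S; split=> [|w Dw]; first by rewrite expr0 mulr1; exact: pairS.
  by rewrite expr0 mulr1 /= /theta_inv -DS.
- exists 0%N, (fun=> c); split=> [|w _]; last by rewrite expr0 mulr1.
  by rewrite expr0 mulr1; exact: alg_pair_cst.
- exists (r + q)%N, (fun w => H w * S w ^+ q + K w * S w ^+ r); split=> [|w Dw].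
    rewrite (_ : _ * _ = f * s ^+ r * s ^+ q + g * s ^+ q * s ^+ r); last by rewrite exprD; ring.
    by apply: alg_pairD; apply: alg_pairM => //; exact: alg_pairX.
  by rewrite -FH// -GK// exprD; ring.
- exists (r + q)%N, (fun w => H w * K w); split=> [|w Dw].
    rewrite (_ : _ * _ = f * s ^+ r * (g * s ^+ q)); last by rewrite exprD; ring.
    exact: alg_pairM.
  by rewrite -FH// -GK// exprD; ring.
Qed.

(** Since 1 - (1 - S)^N is S times a geometric sum, its power 2 r absorbs the denominator S^(2 r) of
    F^2: [K N] is a polynomial in the bounded variables, equals F^2 times the cutoff on D, and
    increases to F^2 there. Squares allow monotone convergence before F is known to be
    integrable. *)
Let integral_sqr F f : alg_pair GX Gy F f ->
  (\int[P]_w (F w ^+ 2)%:E)%E = (L (f * f))%:E.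
Proof.
move=> Ff; have mF := mG Ff; have [r [H [pH FH]]] := clear_denom Ff.
pose cut N w := 1 - (1 - S w) ^+ N.
pose geo N w := \sum_(k < N) (1 - S w) ^+ k.
have cutE N w : cut N w = S w * geo N w.
  rewrite /cut /geo -[X in X - _](expr1n _ N) subrXX opprB addrCA subrr addr0.
  by congr (_ * _); apply: eq_bigr => k _; rewrite expr1n mul1r.
have cut_alg N : 1 - (1 - s) ^+ N = s * \sum_(k < N) (1 - s) ^+ k.
  rewrite -[X in X - _](expr1n _ N) subrXX opprB addrCA subrr addr0.
  by congr (_ * _); apply: eq_bigr => k _; rewrite expr1n mul1r.
pose K N w := (H w) ^+ 2 * geo N w ^+ (2 * r).
have pK N : alg_pair X y (K N) (f * f * (1 - (1 - s) ^+ N) ^+ (2 * r)).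
  rewrite cut_alg exprMn_comm; last exact: mulrC.
  rewrite (_ : _ * _ = (f * s ^+ r) ^+ 2 * (\sum_(k < N) (1 - s) ^+ k) ^+ (2 * r)).
    apply: alg_pairM; first exact: alg_pairX.
    by apply: alg_pairX; apply: alg_pair_sum => k; exact: pair_cut.
  by rewrite mulrA; congr (_ * _); rewrite mul2n -addnn exprD; ring.
have S_itv w : D w -> 0 < S w <= 1.
  by move=> [S0 _]; have /andP[S_ge0 ->] := X01 ord_max w; rewrite andbT lt_def S0.
have cut_itv N w : D w -> 0 <= cut N w <= 1.
  move=> /S_itv /andP[Sw0 Sw1]; rewrite subr_ge0 exprn_ile1 ?subr_ge0//=; last by lra.
  by rewrite gerBl exprn_ge0// subr_ge0.
have KE N w : D w -> K N w = F w ^+ 2 * cut N w ^+ (2 * r).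
  by move=> Dw; rewrite /K -FH// cutE !exprMn -exprM (mulnC r 2) mulrA.
have cvgK w : D w -> K N w @[N --> \oo] --> F w ^+ 2.
  move=> Dw; have /andP[Sw0 Sw1] := S_itv _ Dw.
  rewrite (_ : (fun N => K N w) = fun N => F w ^+ 2 * cut N w ^+ (2 * r)); last first.
    by apply/funext => N; exact: KE.
  rewrite -[X in _ --> X]mulr1; apply: cvgMr.
  rewrite -[X in _ --> X](expr1n _ (2 * r)).
  apply: (continuous_cvg _ (@exprn_continuous R _ _)).
  rewrite -[X in _ --> X]subr0; apply: cvgB; first exact: cvg_cst.
  by apply: cvg_expr; rewrite ger0_norm; lra.
have mK N : measurable_fun [set: measurableTypeR R] (K N).
  by have [[]] := momentX (pK N).
have negl (G : R -> \bar R) : measurable_fun [set: measurableTypeR R] G ->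
    (forall w, 0 <= G w)%E -> (\int[P]_w G w = \int[P]_(w in D) G w)%E.
  move=> mGG G0; rewrite (ge0_negligible_integral (N := ~` D))//.
    by rewrite setTD setCK.
  exact: measurableC.
have K0 N w : 0 <= K N w.
  by rewrite /K mulr_ge0// ?sqr_ge0// exprM exprn_ge0// sqr_ge0.
have EK N : (\int[P]_(w in D) (K N w)%:E)%E =
    (L (f * f * (1 - (1 - s) ^+ N) ^+ (2 * r)))%:E.
  have [bK <-] := momentX (pK N).
  rewrite -negl; [|by apply/measurable_EFinP; exact: mK|by move=> w; rewrite lee_fin].
  by rewrite /Rintegral fineK//; apply: integrable_fin_num => //; exact: bm_integrable.
rewrite negl//; first last.
- by move=> w; rewrite lee_fin sqr_ge0.
- by apply/measurable_EFinP; exact: measurable_funX.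
have -> : (\int[P]_(w in D) (F w ^+ 2)%:E =
    \int[P]_(w in D) limn (fun N => (K N w)%:E))%E.
  apply: eq_integral => w; rewrite inE => Dw; apply/esym/cvg_lim => //.
  by apply: cvg_EFin; [exact: nearW|exact: cvgK].
rewrite (@monotone_convergence _ _ _ P D mD (fun N w => (K N w)%:E))//.
- apply/cvg_lim => //; rewrite (eq_cvg _ _ EK).
  apply: cvg_EFin; first exact: nearW.
  apply: (L_cut_cvg L_sqr L_theta); exact/sos_pos/sos_sqr.
- by move=> N; apply: measurable_funTS; apply/measurable_EFinP; exact: mK.
- by move=> N w _; rewrite lee_fin.
- move=> w Dw N M NM; rewrite lee_fin !KE// ler_wpM2l ?sqr_ge0//.
  have /andP[Sw0 Sw1] := S_itv _ Dw.
  have /andP[c0 _] := cut_itv N w Dw.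
  rewrite lerXn2r ?nnegrE//; first by have /andP[] := cut_itv M w Dw.
  by rewrite /cut lerB// ler_wiXn2l//; lra.
Qed.

(* Polarization: every element is a difference of two squares. *)
Let integrable_eval F f : alg_pair GX Gy F f ->
  P.-integrable setT (EFin \o F) /\ \int[P]_w F w = L f.
Proof.
move=> Ff.
have p1 : alg_pair GX Gy (fun w => F w + 1) (f + 1).
  by apply: alg_pairD => //; exact: alg_pair1.
have p2 : alg_pair GX Gy (fun w => F w - 1) (f - 1).
  by apply: alg_pairB => //; exact: alg_pair1.
have int_sqr G g : alg_pair GX Gy G g ->
    P.-integrable setT (EFin \o (fun w => G w ^+ 2)).
  move=> Gg; apply/integrableP; split.
    by apply/measurable_EFinP; apply: measurable_funX; exact: mG Gg.
  under eq_integral do rewrite gee0_abs ?lee_fin ?sqr_ge0//.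
  by rewrite (integral_sqr Gg) ltry.
have FE : F = (fun w => 4^-1 * ((F w + 1) ^+ 2 - (F w - 1) ^+ 2)).
  by apply/funext => w; field.
have intB : P.-integrable setT
    (EFin \o (fun w => (F w + 1) ^+ 2 - (F w - 1) ^+ 2)).
  rewrite (_ : _ \o _ = (EFin \o (fun w => (F w + 1) ^+ 2)%R) \-
                         (EFin \o (fun w => (F w - 1) ^+ 2)%R))%E.
    by apply: integrableB => //; [exact: int_sqr p1|exact: int_sqr p2].
  by apply/funext => w /=; rewrite EFinB.
split.
  rewrite FE (_ : _ \o _ = (fun w => 4^-1%:E *
      (EFin \o (fun w => (F w + 1) ^+ 2 - (F w - 1) ^+ 2)%R) w)%E).
    exact: integrableZl.
  by apply/funext => w /=; rewrite EFinM.
rewrite FE RintegralZl// RintegralB//; [|exact: int_sqr p1|exact: int_sqr p2].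
rewrite /Rintegral (integral_sqr p1) (integral_sqr p2) /=.
rewrite -raddfB -linearZ /=; congr (L _).
rewrite (_ : _ - _ = f *+ 4); last by ring.
by rewrite -[f *+ 4]scaler_nat scalerA mulVf ?scale1r// pnatr_eq0.
Qed.

Lemma gluing : exists T : 'I_n -> R -> R,
  (forall j, measurable_fun [set: measurableTypeR R] (T j)) /\
  forall F f,
    alg_pair (fun o w => if o is Some j then T j w else (1 + \sum_j T j w ^+ 2)^-1)
             (fun o => if o is Some j then t j else s) F f ->
    P.-integrable setT (EFin \o F) /\ \int[P]_w F w = L f.
Proof.
exists T; split=> // F f; rewrite (_ : (fun _ _ => _) = GX); first exact: integrable_eval.
by apply/funext => -[].
Qed.
End Gluing.

(* Stereographic coordinates S = 1 / (1 + |T|^2) and U = T S are bounded, so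
   the pair (S, U) is obtained from L by de Finetti; then T = U / S. *)
Lemma representation : exists (P : {measure set (measurableTypeR R) -> \bar R})
    (T : 'I_n -> R -> R),
  [/\ (P setT < +oo)%E,
   forall j, measurable_fun [set: measurableTypeR R] (T j) &
   forall F f,
    alg_pair (fun o w => if o is Some j then T j w else (1 + \sum_j T j w ^+ 2)^-1)
             (fun o => if o is Some j then t j else s) F f ->
    P.-integrable setT (EFin \o F) /\ \int[P]_w F w = L f].
Proof.
have [P [X [finP mX X01 EX]]] := variables_of_functional
  (@pos_ge0 _ _ L L_sqr) (fun g i pg => posM pg (pos_y i))
  (fun g i pg => posM pg (pos_1By i)) (pos1 L).
have [T [mT ET]] := gluing finP mX X01 EX.
by exists P, T.
Qed.

End Representation.

(** * Borel sets of R^n *)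

Section Borel.
Context (R : realType) (n : nat).

Lemma measurable_coord (j : 'I_n) :
  measurable_fun [set: borelRn R n] (fun t : borelRn R n => (t : 'rV[R]_n) ord0 j).
Proof.
apply: (measurability _ (RGenOpens.measurableE R)) => _ [_ [a [b ->] <-]].
rewrite setTI; apply: sub_sigma_algebra => /=.
apply: open_comp; last exact: interval_open.
by move=> t _; exact: coord_continuous.
Qed.

(* Every open set is a countable union of cubes with rational centre. *)
Lemma measurable_row d (T : measurableType d) (f : T -> 'I_n -> R) :
  (forall j, measurable_fun [set: T] (fun x => f x j)) ->
  measurable_fun [set: T] ((fun x => \row_j f x j) : T -> borelRn R n).
Proof.
move=> mf; apply: (@measurability _ _ T (borelRn R n) _ _ (@open 'rV[R]_n)) => // _ [U oU <-]; rewrite setTI.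
pose cube (c : 'rV[rat]_n * nat) : set 'rV[R]_n :=
  [set t | forall j, `|ratr (c.1 ord0 j) - t ord0 j| < c.2.+1%:R^-1].
have -> : U = \bigcup_(c in [set c | cube c `<=` U]) cube c.
  apply/seteqP; split => [t Ut|t [c cU]]; last exact: cU.
  have [e e0 eU] : exists2 e : R, 0 < e & ball t e `<=` U.
    by have /nbhs_ballP[e e0 eU] := open_nbhs_nbhs (conj oU Ut); exists e.
  (* Two points of a cube with half-side 1 / (k + 1) are less than 2 / (k + 1) apart, so a cube
     containing t stays in the ball of radius e. *)
  have [k ke] : exists k, 2 * k.+1%:R^-1 < e.
    have /cvgrPdist_lt /(_ (e / 2)) := @cvg_harmonic R.
    rewrite divr_gt0// => /(_ isT) [k _ /(_ k (leqnn k))] /=.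
    rewrite sub0r normrN => /(le_lt_trans (ler_norm _)).
    by rewrite /harmonic => ke; exists k; move: ke; set z := _^-1; lra.
  have k0 : 0 < k.+1%:R^-1 :> R by rewrite invr_gt0.
  have /choice[q tq] (j : 'I_n) : exists q : rat, `|ratr q - t ord0 j| < k.+1%:R^-1.
    move: k0; set z : R := _^-1 => z0.
    have [|q] := @rat_in_itvoo R (t ord0 j - z) (t ord0 j + z); first by lra.
    rewrite in_itv /= => /andP[q1 q2]; exists q; rewrite ltr_norml; apply/andP; split; lra.
  exists (\row_j q j, k) => /=; last by move=> j; rewrite mxE; exact: tq.
  move=> u tu; apply: eU; split=> // i j; rewrite !ord1 /ball /=.
  have := tu j; rewrite mxE => uq; apply: lt_trans ke.
  rewrite (le_lt_trans (ler_distD (ratr (q j)) _ _))// mulr2n mulrDl mul1r.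
  by rewrite distrC ltrD.
rewrite preimage_bigcup.
have mcube c : measurable ((fun x => \row_j f x j) @^-1` cube c).
  rewrite (_ : _ @^-1` _ = \bigcap_(j in [set: 'I_n])
      [set x | `|ratr (c.1 ord0 j) - f x j| < c.2.+1%:R^-1]); last first.
    apply/seteqP; split => x /=.
      by move=> H j _; have := H j; rewrite mxE.
    by move=> H j; rewrite mxE; exact: (H j).
  apply: fin_bigcap_measurable => // j _.
  rewrite -[X in measurable X]setTI.
  have : measurable_fun [set: T] (fun x => `|ratr (c.1 ord0 j) - f x j|).
    by apply: measurableT_comp => //; exact: measurable_funB.
  move=> /(_ measurableT `]-oo, c.2.+1%:R^-1[%classic) => /(_ (measurable_itv _)).
  by rewrite preimage_itvNyo.
rewrite bigcup_mkcond; apply: countable_bigcupT_measurable => [|c].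
  exact: countableP.
by case: ifP.
Qed.
End Borel.

(** * Uniqueness of the measure representing delta *)

Section SignIteration.
Context (R : realType).

(** The Newton-Schulz iteration for the sign: odd, with fixed points -1, 0 and 1, and with vanishing
    derivative at -1 and 1. *)
Definition sign_step (x : R) : R := (3 * x - x ^+ 3) / 2.

Lemma sign_stepN x : sign_step (- x) = - sign_step x.
Proof. by rewrite /sign_step; field. Qed.

Lemma iter_sign_stepN k x : iter k sign_step (- x) = - iter k sign_step x.
Proof. by elim: k => //= k ->; rewrite sign_stepN. Qed.

(** One step p satisfies p(y) - y = y (1 - y^2) / 2 and 1 - p(y) = (1 - y)^2 (2 + y) / 2, both
    nonnegative on [0, 1]. *)
Lemma iter_sign_step_bounds k x : 0 <= x <= 1 -> x <= iter k sign_step x <= 1.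
Proof.
move=> /andP[x0 x1]; elim: k => [|k /andP[IH1 IH2]] /=; first by rewrite lexx.
move: IH1 IH2; set y := iter k _ x => IH1 IH2; rewrite /sign_step.
have y0 : 0 <= y by lra.
have y2 : 0 <= y ^+ 2 <= 1 by rewrite sqr_ge0 expr_le1.
apply/andP; split.
  have : 0 <= y * (1 - y ^+ 2) by apply: mulr_ge0 => //; lra.
  by rewrite (_ : 3 * y - y ^+ 3 = 2 * y + y * (1 - y ^+ 2)); [lra|ring].
have : 0 <= (1 - y) ^+ 2 * (2 + y) by apply: mulr_ge0; [exact: sqr_ge0|lra].
by rewrite (_ : _ * _ = 2 - (3 * y - y ^+ 3)); [lra|ring].
Qed.

(** A step multiplies 1 - y by 1 - (y + y^2) / 2, which is at most 1 - x / 2 because the iterates y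
    stay above x. *)
Lemma sub1_iter_sign_step_le k x : 0 <= x <= 1 ->
  1 - iter k sign_step x <= (1 - x / 2) ^+ k.
Proof.
move=> x01; have /andP[x0 x1] := x01; elim: k => [|k IH] /=.
  by rewrite expr0; lra.
have /andP[yx y1] := iter_sign_step_bounds k x01.
move: IH yx y1; set y := iter k _ x => IH yx y1.
rewrite exprS (_ : 1 - sign_step y = (1 - (y + y ^+ 2) / 2) * (1 - y)); last first.
  by rewrite /sign_step; field.
have y2 : 0 <= y ^+ 2 <= 1 by rewrite sqr_ge0 expr_le1//; lra.
by apply: ler_pM => //; lra.
Qed.

Lemma cvg_iter_sign_step x : `|x| <= 1 ->
  iter k sign_step x @[k --> \oo] --> Num.sg x.
Proof.
have pos_case z : 0 < z <= 1 -> iter k sign_step z @[k --> \oo] --> (1 : R).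
  move=> /andP[z0 z1]; have z01 : 0 <= z <= 1 by lra.
  apply: (@squeeze_cvgr _ _ _ _ (fun k => 1 - (1 - z / 2) ^+ k) (fun=> 1)).
  - apply: nearW => k; have /andP[_ ->] := iter_sign_step_bounds k z01.
    by have := sub1_iter_sign_step_le k z01; rewrite andbT; lra.
  - rewrite -[X in _ --> X]subr0; apply: cvgB; first exact: cvg_cst.
    by apply: cvg_expr; rewrite ger0_norm; lra.
  - exact: cvg_cst.
have [x0|x0|->] := ltrgt0P x => x1.
- by rewrite gtr0_sg//; apply: pos_case; rewrite x0.
- rewrite ltr0_sg// -[x]opprK; under eq_fun do rewrite iter_sign_stepN.
  by apply: cvgN; apply: pos_case; rewrite oppr_gt0 x0.
- rewrite sgr0 (_ : (fun k => _) = fun=> 0); first exact: cvg_cst.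
  by apply/funext; elim=> //= k ->; rewrite /sign_step; field.
Qed.

Lemma iter_sign_step_norm k x : `|x| <= 1 -> `|iter k sign_step x| <= 1.
Proof.
have H z : 0 <= z <= 1 -> `|iter k sign_step z| <= 1.
  move=> z01; have /andP[zx x1] := iter_sign_step_bounds k z01.
  by rewrite ger0_norm//; lra.
have [x0|x0] := leP 0 x.
  by rewrite ger0_norm// => x1; apply: H; rewrite x0.
rewrite ltr0_norm// => x1; rewrite -[x]opprK iter_sign_stepN normrN.
by apply: H; lra.
Qed.
End SignIteration.

Lemma cvg_big_prod (R : realType) (I : Type) (r : seq I) (u : nat -> I -> R)
    (l : I -> R) : (forall i, u k i @[k --> \oo] --> l i) ->
  \prod_(i <- r) u k i @[k --> \oo] --> \prod_(i <- r) l i.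
Proof.
move=> ul; elim: r => [|i r IH].
  by rewrite big_nil; under eq_fun do rewrite big_nil; exact: cvg_cst.
by rewrite big_cons; under eq_fun do rewrite big_cons; exact: cvgM.
Qed.

(** * Polynomials on the graph of 1 / (1 + |t|^2), and the measures they determine *)

Section Evaluation.
Context (R : realType) (n : nat).
Implicit Types (t : 'rV[R]_n) (p : mpoly n.+1 R).

Definition sq_norm1 t : R := 1 + \sum_(j < n) t ord0 j ^+ 2.

Definition graph_pt t (i : 'I_n.+1) : R :=
  if unlift ord_max i is Some j then t ord0 j else (sq_norm1 t)^-1.

Definition graph_eval p t : R := meval (graph_pt t) p.

Lemma graph_evalX p k t : graph_eval (p ^+ k) t = graph_eval p t ^+ k.
Proof.
by elim: k => [|k IH]; rewrite ?expr0 ?exprS /graph_eval ?meval1 ?mevalM// -IH.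
Qed.

Lemma graph_eval_prod (I : Type) (r : seq I) (F : I -> mpoly n.+1 R) t :
  graph_eval (\prod_(i <- r) F i) t = \prod_(i <- r) graph_eval (F i) t.
Proof. exact: (big_morph _ (mevalM _) (meval1 _)). Qed.

Lemma sq_norm1_ge1 t : 1 <= sq_norm1 t.
Proof. by rewrite lerDl sumr_ge0// => j _; exact: sqr_ge0. Qed.

Lemma measurable_graph_pt i :
  measurable_fun [set: borelRn R n] (fun t : borelRn R n => graph_pt t i).
Proof.
rewrite /graph_pt; case: (unlift _ _) => [j|]; first exact: measurable_coord.
have theta0 (t : borelRn R n) : 0 <= sq_norm1 t.
  by apply: le_trans (sq_norm1_ge1 t).
apply: (measurable_funV theta0); apply: measurable_funD => //.
by apply: measurable_sum => j; apply: measurable_funX; exact: measurable_coord.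
Qed.

Lemma measurable_graph_eval p :
  measurable_fun [set: borelRn R n] (graph_eval p : borelRn R n -> R).
Proof.
rewrite /graph_eval; under eq_fun do rewrite mevalE.
apply: measurable_sum => m; apply: measurable_funM => //.
by apply: measurable_prod => i _; apply: measurable_funX; exact: measurable_graph_pt.
Qed.

Lemma graph_evalE p t :
  graph_eval p t = \sum_(m <- msupp p) mcoeff m p * graph_eval (mpolyX R m) t.
Proof.
by rewrite /graph_eval mevalE; apply: eq_bigr => m _; rewrite mevalX.
Qed.

(** Integrability is required explicitly because the real-valued integral returns a number even for
    functions that are not integrable. *)
Definition represents (delta : mseq R n.+1)
    (mu : {measure set (borelRn R n) -> \bar R}) :=
  forall m, mu.-integrable setT (EFin \o (graph_eval (mpolyX R m) : borelRn R n -> R)) /\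
    delta m = (\int[mu]_(t in [set: borelRn R n]) graph_eval (mpolyX R m) t)%:C%C.

Section Represents.
Variables (delta : mseq R n.+1) (mu : {measure set (borelRn R n) -> \bar R}).
Hypothesis rep : represents delta mu.

Lemma represents_integrable p :
  mu.-integrable setT (EFin \o (graph_eval p : borelRn R n -> R)).
Proof.
rewrite (_ : _ \o _ = (fun t => \sum_(m <- msupp p)
    (mcoeff m p)%:E * (EFin \o graph_eval (mpolyX R m)) t)%E).
  by apply: integrable_sum => // m _; apply: integrableZl => //; have [] := rep m.
apply/funext => t /=; rewrite graph_evalE -sumEFin.
by apply: eq_bigr => m _; rewrite EFinM.
Qed.

Lemma represents_integral p :
  \int[mu]_(t in [set: borelRn R n]) graph_eval p t =
  \sum_(m <- msupp p) mcoeff m p * complex.Re (delta m).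
Proof.
rewrite /Rintegral; under eq_integral do rewrite graph_evalE -sumEFin.
rewrite integral_sum//; last first.
  move=> m; under eq_fun do rewrite EFinM.
  by apply: integrableZl => //; have [] := rep m.
rewrite (eq_bigr (fun m => (mcoeff m p * complex.Re (delta m))%:E)).
  by rewrite sumEFin.
move=> m _; have [im ->] := rep m; rewrite /= -RintegralZl// fineK//.
apply: integrable_fin_num => //; under eq_fun do rewrite EFinM.
exact: integrableZl.
Qed.

Lemma represents_finite : (mu setT < +oo)%E.
Proof.
have := represents_integrable 1 => /integrableP[_].
under eq_integral do rewrite /= /graph_eval meval1 normr1.
by rewrite integral_cst// mul1e.
Qed.
End Represents.

Lemma represents_unique (delta : mseq R n.+1)
    (mu nu : {measure set (borelRn R n) -> \bar R}) :
  represents delta mu -> represents delta nu ->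
  forall A : set (borelRn R n), measurable A -> mu A = nu A.
Proof.
move=> rmu rnu.
have Emunu p : \int[mu]_(t in [set: borelRn R n]) graph_eval p t =
    \int[nu]_(t in [set: borelRn R n]) graph_eval p t.
  by rewrite (represents_integral rmu) (represents_integral rnu).
have finmu := represents_finite rmu; have finnu := represents_finite rnu.
pose box (a : 'I_n -> R) : set (borelRn R n) :=
  [set t | forall j, (t : 'rV[R]_n) ord0 j < a j].
have mbox a : measurable (box a).
  rewrite (_ : box a = \bigcap_(j in [set: 'I_n])
      ((fun t : borelRn R n => (t : 'rV[R]_n) ord0 j) @^-1` `]-oo, a j[)).
    apply: fin_bigcap_measurable => // j _; rewrite -[X in measurable X]setTI.
    exact: measurable_coord.
  apply/seteqP; split => t /=.
    by move=> H j _; rewrite /preimage /= in_itv /=; exact: H.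
  by move=> H j; have := H j Logic.I; rewrite /preimage /= in_itv.
have box_eq a : mu (box a) = nu (box a).
  (* The sign of (a_j - t_j) s tells whether t_j < a_j. Dividing by |a_j| + 1 brings it into
     [-1, 1], where the iteration converges, since |t_j| <= 1 + |t|^2. *)
  pose f j : mpoly n.+1 R := (`|a j| + 1)^-1 *:
    ((a j)%:A * mpolyX R (mnm1 ord_max) -
     mpolyX R (mnm1 (lift ord_max j)) * mpolyX R (mnm1 ord_max)).
  have fE j t : graph_eval (f j) t =
      (`|a j| + 1)^-1 * ((a j - t ord0 j) / sq_norm1 t).
    rewrite /graph_eval /f mevalZ mevalB !mevalM -mul_mpolyC mulr1 mevalC !mevalXU.
    by rewrite /graph_pt liftK unlift_none mulrBl.
  have f1 j t : `|graph_eval (f j) t| <= 1.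
    have theta1 := sq_norm1_ge1 t; have theta0 : 0 < sq_norm1 t by lra.
    have a1 : 0 < `|a j| + 1 by have := normr_ge0 (a j); lra.
    rewrite fE !normrM !normfV (gtr0_norm theta0) (gtr0_norm a1).
    rewrite mulrC ler_pdivrMr// mul1r ler_pdivrMr// (le_trans (ler_normB _ _))//.
    have tj : `|t ord0 j| <= sq_norm1 t.
      rewrite /sq_norm1 (bigD1 j)//= -(real_normK (num_real (t ord0 j))).
      have : 0 <= \sum_(i < n | i != j) t ord0 i ^+ 2.
        by apply: sumr_ge0 => i _; exact: sqr_ge0.
      have := sqr_ge0 (`|t ord0 j| - 1); set x := `|t ord0 j|; set y := \sum_(_ | _) _.
      by have x0 : 0 <= x := normr_ge0 _; rewrite sqrrB1 => ? ?; lra.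
    rewrite mulrDl mul1r lerD// ler_peMr//.
  pose stepp (p : mpoly n.+1 R) : mpoly n.+1 R := 2^-1 *: (3 *: p - p ^+ 3).
  have steppE p t : graph_eval (stepp p) t = sign_step (graph_eval p t).
    by rewrite /graph_eval /stepp mevalZ mevalB mevalZ -!/(graph_eval _ _) graph_evalX mulrC.
  have iterE k p t : graph_eval (iter k stepp p) t = iter k (@sign_step R) (graph_eval p t).
    by elim: k => //= k IH; rewrite steppE IH.
  (* The polynomial (u^2 + u) / 2 sends the signs -1, 0, 1 to 0, 0, 1, which yields the strict
     inequality defining the box. *)
  pose Q k : mpoly n.+1 R := \prod_(j < n)
    (2^-1 *: (iter k stepp (f j) ^+ 2 + iter k stepp (f j))).
  have QE k t : graph_eval (Q k) t = \prod_(j < n)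
      (2^-1 * (iter k (@sign_step R) (graph_eval (f j) t) ^+ 2 +
               iter k (@sign_step R) (graph_eval (f j) t))).
    rewrite graph_eval_prod; apply: eq_bigr => j _.
    by rewrite /graph_eval mevalZ mevalD -!/(graph_eval _ _) graph_evalX !iterE.
  have Q1 k t : `|graph_eval (Q k) t| <= 1.
    rewrite QE normr_prod; apply: prodr_ile1 => j _; rewrite normr_ge0 /=.
    have := iter_sign_step_norm k (f1 j t); set u := iter _ _ _ => u1.
    rewrite normrM ger0_norm ?invr_ge0// ler_pdivrMl// mulr1.
    rewrite (le_trans (ler_normD _ _))// normrX.
    have : `|u| ^+ 2 <= 1 by rewrite expr_le1.
    by lra.
  have Qcvg t : graph_eval (Q k) t @[k --> \oo] --> (\1_(box a) t : R).
    rewrite (_ : \1_(box a) t = \prod_(j < n)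
        (2^-1 * (Num.sg (graph_eval (f j) t) ^+ 2 + Num.sg (graph_eval (f j) t)))).
      under eq_fun do rewrite QE.
      apply: cvg_big_prod => j; apply: cvgMr; have cj := cvg_iter_sign_step (f1 j t).
      by apply: cvgD => //; apply: (continuous_cvg _ (@exprn_continuous R _ _)).
    have sgE j : 2^-1 * (Num.sg (graph_eval (f j) t) ^+ 2 + Num.sg (graph_eval (f j) t)) =
        (t ord0 j < a j)%R%:R.
      have theta0 : 0 < sq_norm1 t by have := sq_norm1_ge1 t; lra.
      have a1 : 0 < (`|a j| + 1)^-1 by rewrite invr_gt0; have := normr_ge0 (a j); lra.
      rewrite fE sgrM (gtr0_sg a1) mul1r sgrM [Num.sg _^-1]gtr0_sg ?invr_gt0// mulr1.
      case: (ltrgtP (t ord0 j) (a j)) => [lt|gt|->].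
      - by rewrite gtr0_sg ?subr_gt0// expr1n mulr1n; lra.
      - by rewrite ltr0_sg ?subr_lt0// sqrrN expr1n subrr mulr0.
      - by rewrite subrr sgr0 expr0n addr0 mulr0.
    under eq_bigr do rewrite sgE.
    rewrite indicE; case: (boolP (t \in _)); rewrite ?inE ?notin_setE => tbox.
      by rewrite big1// => j _; rewrite tbox.
    have /existsNP[j /negP tj] := tbox.
    by rewrite (bigD1 j)//= (negbTE tj) mul0r.
  have E (la : {measure set (borelRn R n) -> \bar R}) : (la setT < +oo)%E ->
     \int[la]_(t in [set: borelRn R n]) graph_eval (Q k) t @[k --> \oo] --> fine (la (box a)).
    move=> finla.
    rewrite (_ : fine _ = \int[la]_(t in [set: borelRn R n]) \1_(box a) t); last first.
      by rewrite /Rintegral integral_indic// setIT.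
    apply: (bounded_convergence finla (M := 1)).
    - by move=> k; exact: measurable_graph_eval.
    - exact: measurable_indic.
    - by move=> k t; exact: Q1.
    - by apply: aeW => t; exact: Qcvg.
  have Emu := E _ finmu; have Enu := E _ finnu.
  rewrite (eq_cvg _ _ (fun k => Emunu (Q k))) in Emu.
  have box_fin (la : {measure set (borelRn R n) -> \bar R}) :
      (la setT < +oo)%E -> la (box a) \is a fin_num.
    move=> finla; rewrite ge0_fin_numE//; apply: le_lt_trans finla.
    by apply: le_measure; rewrite ?inE.
  rewrite -(fineK (box_fin _ finmu)) -(fineK (box_fin _ finnu)); congr _%:E.
  by rewrite -(cvg_lim (@Rhausdorff R) Emu) (cvg_lim (@Rhausdorff R) Enu).
(* Boxes are closed under intersection and the [g k] exhaust the space, so agreement on boxes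
   extends to the sigma-algebra they generate. It remains to see that it contains the Borel sets. *)
pose G : set (set (borelRn R n)) := range box.
pose g (k : nat) := box (fun=> k%:R).
have GU : \bigcup_k (g k) = setT.
  apply/seteqP; split => // t _.
  exists (Num.bound (\sum_(j < n) `|(t : 'rV[R]_n) ord0 j|)) => // j.
  apply: le_lt_trans (archi_boundP _); last by apply: sumr_ge0.
  by rewrite (le_trans (ler_norm _))// (bigD1 j)//= lerDl sumr_ge0.
have GI : setI_closed G.
  move=> _ _ [a _ <-] [b _ <-]; exists (fun j => Num.min (a j) (b j)) => //.
  apply/seteqP; split => t /=.
    by move=> H; split => j; have := H j; rewrite lt_min => /andP[].
  by move=> [Ha Hb] j; rewrite lt_min Ha Hb.
have GE : forall E, <<s G >> E -> mu E = nu E.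
  apply: (@g_sigma_algebra_measure_unique _ R _ G _ g) => //.
  - by move=> _ [a _ <-]; exact: mbox.
  - by move=> k; exists (fun=> k%:R).
  - by move=> _ [a _ <-]; exact: box_eq.
  - move=> k; apply: le_lt_trans finmu; apply: le_measure; rewrite ?inE//.
    exact: mbox.
move=> A mA; apply: GE.
(* The identity, viewed as a map from the sigma-algebra of boxes to the Borel one; its measurability
   is the missing inclusion. *)
pose row_id : g_sigma_algebraType G -> borelRn R n :=
  fun t => \row_j ((t : 'rV[R]_n) ord0 j).
have mrow : measurable_fun [set: g_sigma_algebraType G] row_id.
  apply: measurable_row => j.
  apply: (measurability _ (RGenInftyO.measurableE R)) => _ [_ [x ->] <-].
  (* A half-space t_j < x is the union of the boxes whose other bounds equal k. *)
  rewrite setTI (_ : _ @^-1` _ = \bigcup_k box (fun i => if i == j then x else k%:R)).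
    apply: bigcup_measurable => k _; apply: sub_sigma_algebra.
    by exists (fun i => if i == j then x else k%:R).
  apply/seteqP; split => t /=; rewrite /preimage /= in_itv /=.
    move=> tj; exists (Num.bound (\sum_(j < n) `|(t : 'rV[R]_n) ord0 j|)) => // i.
    case: eqP => [->//|_].
    apply: le_lt_trans (archi_boundP _); last by apply: sumr_ge0.
    by rewrite (le_trans (ler_norm _))// (bigD1 i)//= lerDl sumr_ge0.
  by move=> [k _ /(_ j)]; rewrite eqxx.
have := mrow measurableT A mA; rewrite setTI.
rewrite (_ : _ @^-1` A = A)//; apply/seteqP; split => t; rewrite /preimage /=;
  rewrite (_ : row_id t = t)//; apply/rowP => j; rewrite mxE//.
Qed.
End Evaluation.

(** * From delta to a representing measure *)

Lemma sum_msupp_sub (K : nzRingType) (N : nat) (c : multinom N -> K)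
    (p : mpoly N K) (r : seq (multinom N)) :
  uniq r -> {subset msupp p <= r} ->
  \sum_(m <- msupp p) mcoeff m p * c m = \sum_(m <- r) mcoeff m p * c m.
Proof.
move=> ur sub; rewrite [RHS](bigID (fun m => m \in msupp p)) /=.
rewrite [X in _ = _ + X]big1 ?addr0; last first.
  by move=> m /memN_msupp_eq0 ->; rewrite mul0r.
rewrite -[RHS]big_filter; apply: perm_big; apply: uniq_perm.
- exact: msupp_uniq.
- exact: filter_uniq.
- by move=> m; rewrite mem_filter; case: (boolP (m \in msupp p)) => //= /sub ->.
Qed.

Lemma sum_msupp_linear (K : nzRingType) (N : nat) (c : multinom N -> K) :
  linear_for *%R (fun p : mpoly N K => \sum_(m <- msupp p) mcoeff m p * c m).
Proof.
move=> a p q; pose r := undup (msupp p ++ msupp q).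
have ur : uniq r by exact: undup_uniq.
rewrite !(@sum_msupp_sub _ _ _ _ r)// => [|m|m|m].
- rewrite mulr_sumr -big_split; apply: eq_bigr => m _ /=.
  by rewrite mcoeffD mcoeffZ mulrDl mulrA.
- by rewrite mem_undup mem_cat => ->; rewrite orbT.
- by rewrite mem_undup mem_cat => ->.
- rewrite mem_undup => /msuppD_le; rewrite !mem_cat => /orP[/msuppZ_le ->//|->].
  by rewrite orbT.
Qed.

Section RealFunctional.
Context (R : realType) (N : nat) (delta : mseq R N).

(** The representation is obtained over a real algebra. Taking real parts loses nothing for a
    positive semi-definite delta, by [psd_mseq_real]. *)
Definition real_functional (p : mpoly N R) : R :=
  \sum_(m <- msupp p) mcoeff m p * complex.Re (delta m).

HB.instance Definition _ := GRing.isLinear.Build R (mpoly N R) R *%R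
  real_functional (sum_msupp_linear (fun m => complex.Re (delta m))).

Lemma real_functionalX m : real_functional (mpolyX R m) = complex.Re (delta m).
Proof. by rewrite /real_functional msuppX big_seq1 mcoeffX eqxx mul1r. Qed.

Definition cpoly (p : mpoly N R) : mpoly N R[i] := map_mpoly (real_complex R) p.

Lemma mfunctional_cpoly p : mfunctional delta (cpoly p) =
  (real_functional p +i* \sum_(m <- msupp p) mcoeff m p * complex.Im (delta m))%C.
Proof.
rewrite /mfunctional /real_functional.
have pm : perm_eq (msupp (cpoly p)) (msupp p).
  exact/msupp_map_mpoly/fmorph_inj.
rewrite (perm_big _ pm) /=; elim: (msupp p) => [|m r IH]; first by rewrite !big_nil.
rewrite !big_cons {}IH mcoeff_map_mpoly /=.
by case: (delta m) => a b; apply/eqP; rewrite eq_complex /= !mul0r subr0 addr0 !eqxx.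
Qed.

Lemma conj_cpoly p : conj_mpoly (cpoly p) = cpoly p.
Proof.
apply/mpolyP => m; transitivity (conjc (mcoeff m (cpoly p))).
  exact: mcoeff_map_mpoly.
by rewrite mcoeff_map_mpoly; exact: conjc_real.
Qed.

Hypothesis psd : psd_mseq delta.

Lemma real_functional_sqr p : 0 <= real_functional (p * p).
Proof.
have := psd (cpoly p); rewrite conj_cpoly -rmorphM /= mfunctional_cpoly.
by rewrite lecE /= => /andP[].
Qed.

(** The imaginary part of the functional vanishes on squares of real polynomials, and 4 x = (x +
    1)^2 - (x - 1)^2 for every monomial x. *)
Lemma psd_mseq_real m : delta m = (complex.Re (delta m))%:C%C.
Proof.
pose f p := \sum_(m <- msupp p) mcoeff m p * complex.Im (delta m).
have f_sqr q : f (q * q) = 0.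
  have := psd (cpoly q); rewrite conj_cpoly -rmorphM /= mfunctional_cpoly.
  by rewrite lecE /= => /andP[/eqP].
have fX : f (mpolyX R m) = complex.Im (delta m).
  by rewrite /f msuppX big_seq1 mcoeffX eqxx mul1r.
have f_lin a p q : f (a *: p + q) = a * f p + f q by exact: sum_msupp_linear.
set x := mpolyX R m in fX.
have sq : (x + 1) * (x + 1) = 4 *: x + (x - 1) * (x - 1) by rewrite scaler_nat; ring.
have := f_lin 4 x ((x - 1) * (x - 1)).
rewrite -sq !f_sqr addr0 fX => /esym/eqP; rewrite mulf_eq0 pnatr_eq0 /= => /eqP Im0.
by apply/eqP; rewrite eq_complex /= Im0 !eqxx.
Qed.
End RealFunctional.

Section DimExtension.
Context (R : realType) (n : nat).

Local Notation "'t_ j" := (mpolyX R (mnm1 (lift ord_max j))) (at level 8, j at level 2).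
Local Notation s := (mpolyX R (mnm1 ord_max)).

Lemma lift_ord_max (j : 'I_n) : lift ord_max j = widen_ord (leqnSn n) j.
Proof. by apply/val_inj; exact: lift_max. Qed.

Lemma mpair_lift (alpha : multinom n) beta j : mpair alpha beta (lift ord_max j) = alpha j.
Proof.
rewrite /mpair mnmDE mulmnE mnm1E lift_ord_max mnmwiden_widen -lift_ord_max.
by rewrite (negbTE (neq_lift _ _)) mul0n addn0.
Qed.

Lemma mpair_max (alpha : multinom n) beta : mpair alpha beta ord_max = beta.
Proof. by rewrite /mpair mnmDE mulmnE mnm1E mnmwiden_ordmax eqxx mul1n. Qed.

Lemma multinom_split (m1 m2 : multinom n.+1) :
  (forall j, m1 (lift ord_max j) = m2 (lift ord_max j)) ->
  m1 ord_max = m2 ord_max -> m1 = m2.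
Proof.
move=> Hl Hm; apply/mnmP => i.
by case: (unliftP ord_max i) => [j ->|->].
Qed.

Lemma mpair_surj (m : multinom n.+1) : exists alpha beta, m = mpair alpha beta.
Proof.
exists (Multinom [tuple m (lift ord_max j) | j < n]), (m ord_max).
by apply: multinom_split => [j|]; rewrite ?mpair_lift ?mpair_max ?mnmE.
Qed.

(** The right-hand side has the shape of the recurrence for delta, which thus says that
    multiplication by s (1 + |t|^2) does not change the functional. *)
Lemma mpolyX_theta (alpha : multinom n) beta :
  mpolyX R (mpair alpha beta) * (s * (1 + \sum_j 't_j * 't_j)) =
  mpolyX R (mpair alpha beta.+1) +
  \sum_(j < n) mpolyX R (mpair (mnm_add alpha (mnm_muln (mnm1 j) 2)) beta.+1).
Proof.
rewrite [s * _]mulrDr mulr1 mulrDr !mulr_sumr; congr (_ + _).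
  rewrite -mpolyXD; congr (mpolyX R _).
  apply: multinom_split => [j|]; rewrite [LHS]mnmDE mnm1E.
    by rewrite !mpair_lift (negbTE (neq_lift _ _)) addn0.
  by rewrite !mpair_max eqxx addn1.
apply: eq_bigr => j _; rewrite -!mpolyXD; congr (mpolyX R _).
apply: multinom_split => [k|]; rewrite [LHS]mnmDE.
  rewrite !mpair_lift !mnmDE !mnm1E (negbTE (neq_lift _ _)) add0n.
  by rewrite (inj_eq (@lift_inj _ _)).
rewrite !mpair_max !mnmDE !mnm1E eqxx eq_sym.
by rewrite (negbTE (neq_lift _ _)) addn1.
Qed.

Section Existence.
Variables (gamma : mseq R n) (delta : mseq R n.+1).
Hypothesis ext : dim_extension gamma delta.

Lemma real_functional_theta a :
  real_functional delta (a * (s * (1 + \sum_j 't_j * 't_j))) = real_functional delta a.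
Proof.
rewrite [a]mpolyE mulr_suml !raddf_sum; apply: eq_bigr => m _ /=.
rewrite -scalerAl !linearZ /=; congr (_ * _).
have [_ _ rec] := ext; have [alpha [beta ->]] := mpair_surj m.
rewrite mpolyX_theta [RHS]real_functionalX rec !raddfD !raddf_sum /=.
by rewrite real_functionalX; congr (_ + _); apply: eq_bigr => j _; exact: real_functionalX.
Qed.

Lemma dim_extension_represents : exists mu, represents delta mu.
Proof.
have [psd _ _] := ext.
have [P [T [finP mT ET]]] := @representation R (mpoly n.+1 R) (real_functional delta)
  (real_functional_sqr psd) n (fun j => 't_j) s real_functional_theta.
(* The measure sought is the law of T under P. *)
pose phi (w : measurableTypeR R) : borelRn R n := \row_j T j w.
have mphi : measurable_fun setT phi by exact: measurable_row.
pose mu : {measure set (borelRn R n) -> \bar R} :=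
  pushforward P phi.
exists (mu mphi) => m.
pose F (w : measurableTypeR R) := graph_eval (mpolyX R m) (phi w).
have [intF EF] : P.-integrable setT (EFin \o F) /\
    \int[P]_w F w = real_functional delta (mpolyX R m).
  apply: ET; rewrite [mpolyX R m]mpolyXE_id.
  rewrite (_ : F = fun w => \prod_(i < n.+1) graph_pt (phi w) i ^+ m i).
    apply: alg_pair_prod => i.
    apply: alg_pairX; rewrite /graph_pt.
    case: (unliftP ord_max i) => [j ->|->].
      have := alg_pair_gen (fun (o : option 'I_n) w => if o is Some j then T j w
        else (1 + \sum_j T j w ^+ 2)^-1)
        (fun o : option 'I_n => if o is Some j then 't_j else s) (Some j).
      by congr alg_pair; apply/funext => w; rewrite mxE.
    have := alg_pair_gen (fun (o : option 'I_n) w => if o is Some j then T j w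
        else (1 + \sum_j T j w ^+ 2)^-1)
        (fun o : option 'I_n => if o is Some j then 't_j else s) None.
    congr alg_pair; apply/funext => w; rewrite /sq_norm1; congr (_ + _)^-1.
    by apply: eq_bigr => j _; rewrite mxE.
  by apply/funext => w; rewrite /F /graph_eval mevalX.
have mev : measurable_fun [set: borelRn R n]
    (EFin \o (graph_eval (mpolyX R m) : borelRn R n -> R)).
  by apply/measurable_EFinP; exact: measurable_graph_eval.
split; first exact: (integrable_pushforward mphi mev intF).
rewrite (psd_mseq_real psd) -real_functionalX -EF; congr (_%:C)%C.
by rewrite /Rintegral; congr fine; rewrite (integral_pushforward mphi mev intF).
Qed.
End Existence.

Lemma cpoly_decomp (N : nat) (f : mpoly N R[i]) :
  exists a b : mpoly N R, f = cpoly a + (0 +i* 1)%C *: cpoly b.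
Proof.
exists (\sum_(m <- msupp f) complex.Re (mcoeff m f) *: mpolyX R m),
       (\sum_(m <- msupp f) complex.Im (mcoeff m f) *: mpolyX R m).
have sumE (c : multinom N -> R) : cpoly (\sum_(m <- msupp f) c m *: mpolyX R m) =
    \sum_(m <- msupp f) (c m)%:C%C *: mpolyX R[i] m.
  transitivity (\sum_(m <- msupp f) cpoly (c m *: mpolyX R m)).
    exact: (raddf_sum (map_mpoly (real_complex R))).
  by apply: eq_bigr => m _; rewrite /cpoly map_mpolyZ map_mpolyX.
rewrite !sumE scaler_sumr -big_split {1}[f]mpolyE.
apply: eq_bigr => m _ /=; rewrite scalerA -scalerDl.
congr (_ *: _); case: (mcoeff m f) => x y.
by apply/eqP; rewrite eq_complex /=; apply/andP; split; apply/eqP; ring.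
Qed.

Lemma mpoly_fun_cpoly (a : mpoly n R) (t : 'rV[R]_n) :
  mpoly_fun (cpoly a) t = (graph_eval (mwiden a) t)%:C%C.
Proof.
elim/mpolyind: a => [|c m p _ _ IH].
  by rewrite /cpoly raddf0 /mpoly_fun meval0 mwiden0 /graph_eval meval0.
have -> : cpoly (c *: mpolyX R m + p) = c%:C%C *: mpolyX R[i] m + cpoly p.
  by rewrite /cpoly raddfD /= map_mpolyZ map_mpolyX.
rewrite /mpoly_fun mevalD -[meval _ (cpoly p)]/(mpoly_fun (cpoly p) t) IH.
rewrite mwidenD /graph_eval mevalD rmorphD; congr (_ + _).
rewrite mwidenZ mwidenX !mevalZ rmorphM; congr (_ * _).
rewrite !mevalX rmorph_prod big_ord_recr /= mnmwiden_ordmax expr0 mulr1.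
apply: eq_bigr => j _; rewrite mnmwiden_widen rmorphXn /=.
by rewrite /graph_pt -lift_ord_max liftK.
Qed.

Lemma mpoly_funE (p : mpoly n R[i]) : exists a b : mpoly n.+1 R,
  forall t, mpoly_fun p t = (graph_eval a t +i* graph_eval b t)%C.
Proof.
have [a [b ->]] := cpoly_decomp p; exists (mwiden a), (mwiden b) => t.
transitivity ((graph_eval (mwiden a) t)%:C + (0 +i* 1) * (graph_eval (mwiden b) t)%:C)%C.
  by rewrite -!mpoly_fun_cpoly /mpoly_fun mevalD mevalZ.
by apply/eqP; rewrite eq_complex /=; apply/andP; split; apply/eqP; ring.
Qed.

Lemma graph_eval_mpair (alpha : multinom n) (beta : nat) (t : 'rV[R]_n) :
  graph_eval (mpolyX R (mpair alpha beta)) t =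
  monomial_fun alpha t * (sq_norm1 t)^-1 ^+ beta.
Proof.
rewrite /graph_eval mevalX big_ord_recr /= mpair_max /graph_pt unlift_none.
congr (_ * _); apply: eq_bigr => j _.
by rewrite -lift_ord_max mpair_lift liftK.
Qed.

(** With real a and b, |a + i b|^2 = a^2 + b^2 is again a polynomial on the graph, so its
    integrability gives the L^2 condition; gamma is read off at beta = 0. *)
Lemma represents_representing_measure (gamma : mseq R n) delta mu :
  dim_extension gamma delta -> represents delta mu -> representing_measure gamma mu.
Proof.
move=> [_ gd _] rep; split=> [p|alpha]; last first.
  rewrite gd; have [_ ->] := rep (mpair alpha 0); congr (_%:C)%C.
  by apply: eq_Rintegral => t _; rewrite graph_eval_mpair expr0 mulr1.
have [a [b E]] := mpoly_funE p; split.
- under eq_fun do rewrite E /=; exact: measurable_graph_eval.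
- under eq_fun do rewrite E /=; exact: measurable_graph_eval.
have := represents_integrable rep (a * a + b * b) => /integrableP[_].
apply: le_lt_trans; rewrite le_eqVlt; apply/orP; left; apply/eqP.
apply: eq_integral => t _; rewrite E /ComplexField.Normc.normc /= sqr_sqrtr; last first.
  by rewrite addr_ge0// sqr_ge0.
rewrite /graph_eval mevalD !mevalM -!expr2 ger0_norm//.
by rewrite addr_ge0// sqr_ge0.
Qed.
End DimExtension.

(** * From a representing measure to delta *)

Lemma mul_conj_factor (K : comNzRingType) (A : comAlgType K) (i : K) (a b : A) :
  i * i = -1 -> (a + i *: b) * (a + - i *: b) = a * a + b * b.
Proof.
move=> ii; rewrite scaleNr; set x := i *: b.
have xx : x * x = - (b * b) by rewrite /x -scalerAl -scalerAr scalerA ii scaleN1r.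
have -> : (a + x) * (a - x) = a * a - x * x by ring.
by rewrite xx opprK.
Qed.

Lemma mcoeff_cpoly (R : realType) (N : nat) (a : mpoly N R) m :
  mcoeff m (cpoly a) = (mcoeff m a)%:C%C.
Proof. exact: mcoeff_map_mpoly. Qed.

Lemma conj_mpoly_decomp (R : realType) (N : nat) (a b : mpoly N R) (c : R[i]) :
  conj_mpoly (cpoly a + c *: cpoly b) = cpoly a + conjc c *: cpoly b.
Proof.
apply/mpolyP => m.
transitivity (conjc (mcoeff m (cpoly a + c *: cpoly b))); first exact: mcoeff_map_mpoly.
rewrite !mcoeffD !mcoeffZ !mcoeff_cpoly rmorphD rmorphM.
by congr (_ + _ * _); exact: conjc_real.
Qed.

Section Converse.
Context (R : realType) (n : nat) (gamma : mseq R n).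
Variable mu : {measure set (borelRn R n) -> \bar R}.
Hypothesis rep : representing_measure gamma mu.

Let sqr_integrable (alpha : multinom n) : mu.-integrable setT
  (EFin \o (fun t : borelRn R n => monomial_fun alpha t ^+ 2)).
Proof.
have monoE : monomial_fun alpha = graph_eval (mpolyX R (mpair alpha 0)).
  by apply/funext => t; rewrite graph_eval_mpair expr0 mulr1.
have [_ _ fin] := rep.1 (mpolyX R[i] alpha).
apply/integrableP; split.
  apply/measurable_EFinP; apply: measurable_funX; rewrite monoE.
  exact: measurable_graph_eval.
apply: le_lt_trans fin; rewrite le_eqVlt; apply/orP; left; apply/eqP.
apply: eq_integral => t _ /=; rewrite ger0_norm ?sqr_ge0//; congr (_%:E).
have -> : mpoly_fun (mpolyX R[i] alpha) t = (monomial_fun alpha t)%:C%C.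
  rewrite /mpoly_fun mevalX rmorph_prod /=; apply: eq_bigr => j _.
  by rewrite rmorphXn.
by rewrite /ComplexField.Normc.normc /= expr0n addr0 sqr_sqrtr// sqr_ge0.
Qed.

Lemma representing_measure_finite : (mu setT < +oo)%E.
Proof.
have /integrableP[_] := sqr_integrable (@mnm0 n).
rewrite (_ : (fun _ => _) = cst 1%E) ?integral_cst ?mul1e//.
apply/funext => t /=; rewrite /monomial_fun big1 ?expr1n ?normr1// => j _.
by rewrite mnm0E expr0.
Qed.

(** Since 0 < s <= 1, |t^alpha s^beta| <= |t^alpha| <= 1 + t^(2 alpha), and the L^2 condition makes
    the last function integrable. *)
Lemma representing_measure_integrable m : mu.-integrable setT
  (EFin \o (graph_eval (mpolyX R m) : borelRn R n -> R)).
Proof.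
have [alpha [beta ->]] := mpair_surj m.
have int1 : mu.-integrable setT (EFin \o (fun=> 1) : borelRn R n -> \bar R).
  apply: (bounded_integrable (M := 1)) => // [|t _]; last by rewrite normr1.
  exact: representing_measure_finite.
apply: le_integrable (integrableD measurableT int1 (sqr_integrable alpha)) => //.
  by apply/measurable_EFinP; exact: measurable_graph_eval.
move=> t _ /=; rewrite lee_fin graph_eval_mpair normrM.
have theta1 := sq_norm1_ge1 (t : 'rV[R]_n).
have theta0 : 0 < sq_norm1 (t : 'rV[R]_n) by lra.
rewrite [leRHS]ger0_norm ?addr_ge0 ?sqr_ge0//.
apply: (@le_trans _ _ (`|monomial_fun alpha t| * 1)).
  have inv0 : 0 <= (sq_norm1 t)^-1 by rewrite invr_ge0 ltW.
  have inv1 : (sq_norm1 t)^-1 <= 1 by rewrite invf_le1.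
  apply: ler_wpM2l => //; rewrite ger0_norm; last exact: exprn_ge0.
  exact: exprn_ile1.
rewrite mulr1 -(real_normK (num_real (monomial_fun alpha t))).
have := sqr_ge0 (`|monomial_fun alpha t| - 1); have := normr_ge0 (monomial_fun alpha t).
by set x := `|_|; rewrite sqrrB1 => ? ?; lra.
Qed.

Definition extension_of : mseq R n.+1 := fun m =>
  (\int[mu]_(t in [set: borelRn R n]) graph_eval (mpolyX R m) t)%:C%C.

Lemma extension_of_represents : represents extension_of mu.
Proof. by move=> m; split=> //; exact: representing_measure_integrable. Qed.

Let integralE p : \int[mu]_(t in [set: borelRn R n]) graph_eval p t =
  real_functional extension_of p.
Proof. exact: represents_integral extension_of_represents p. Qed.

(** A polynomial a + i b times its conjugate is a^2 + b^2, which gives positivity; the recurrence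
    holds because s (1 + |t|^2) = 1 pointwise on the graph. *)
Lemma extension_of_dim_extension : dim_extension gamma extension_of.
Proof.
split=> [f|alpha|alpha beta].
- have [a [b ->]] := cpoly_decomp f.
  have -> : (cpoly a + (0 +i* 1)%C *: cpoly b) *
      conj_mpoly (cpoly a + (0 +i* 1)%C *: cpoly b) = cpoly (a * a + b * b).
    rewrite conj_mpoly_decomp.
    have -> : cpoly (a * a + b * b) = cpoly a * cpoly a + cpoly b * cpoly b.
      by rewrite /cpoly rmorphD !rmorphM.
    have conj_i : conjc (0 +i* 1)%C = - (0 +i* 1)%C :> R[i].
      by apply/eqP; rewrite eq_complex /= oppr0 !eqxx.
    rewrite conj_i; apply: mul_conj_factor.
    by apply/eqP; rewrite eq_complex /=; apply/andP; split; apply/eqP; ring.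
  rewrite mfunctional_cpoly lecE /= big1 ?eqxx /=; last by move=> m _; rewrite mulr0.
  rewrite -integralE; apply: Rintegral_ge0 => t _.
  by rewrite /graph_eval mevalD !mevalM addr_ge0// -expr2 sqr_ge0.
- rewrite (rep.2 alpha); congr (_%:C)%C.
  by apply: eq_Rintegral => t _; rewrite graph_eval_mpair expr0 mulr1.
rewrite -rmorph_sum -rmorphD; congr (_%:C)%C.
under eq_bigr do rewrite integralE.
rewrite (integralE (mpolyX R (mpair alpha beta.+1))).
transitivity (real_functional extension_of (mpolyX R (mpair alpha beta.+1) +
  \sum_(j < n) mpolyX R (mpair (mnm_add alpha (mnm_muln (mnm1 j) 2)) beta.+1)));
  last by rewrite raddfD raddf_sum.
rewrite -mpolyX_theta -integralE; apply: eq_Rintegral => t _.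
rewrite /graph_eval mevalM mevalM mevalD meval1 raddf_sum /=.
have -> : meval (graph_pt t) (mpolyX R (mnm1 ord_max)) = (sq_norm1 t)^-1.
  by rewrite mevalXU /graph_pt unlift_none.
rewrite (_ : 1 + _ = sq_norm1 t); last first.
  congr (1 + _); apply: eq_bigr => j _; rewrite mevalM !mevalXU /graph_pt liftK.
  by rewrite expr2.
by rewrite mulVf ?mulr1// gt_eqF// (lt_le_trans ltr01)// sq_norm1_ge1.
Qed.
End Converse.

Theorem theorem2p8 (R : realType) (n : nat) (hn : (0 < n)%N)
    (gamma : mseq R n) (hgamma : 0 < gamma (@mnm0 n)) :
  (moment_mseq gamma <-> exists delta : mseq R n.+1, dim_extension gamma delta)
  /\
  (unique_representing_measure gamma <->
   exists! delta : mseq R n.+1, dim_extension gamma delta).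
Proof.
split; split.
- move=> [mu rep]; exists (extension_of mu); exact: extension_of_dim_extension.
- move=> [delta ext]; have [mu rep] := dim_extension_represents ext.
  exists mu; exact: represents_representing_measure ext rep.
(* Any other delta is represented by some nu, which also represents gamma; then nu = mu on Borel
   sets, and delta consists of the same integrals as [extension_of mu]. *)
- move=> [mu [rep uniq_mu]]; exists (extension_of mu); split.
    exact: extension_of_dim_extension.
  move=> delta ext; have [nu nu_rep] := dim_extension_represents ext.
  have nu_mu := uniq_mu nu (represents_representing_measure ext nu_rep).
  apply/funext => m; have [_ ->] := nu_rep m; congr (_%:C)%C; congr fine.
  by apply: eq_measure_integral => A mA _; rewrite nu_mu.
- move=> [delta [ext uniq_delta]]; have [mu mu_rep] := dim_extension_represents ext.
  exists mu; split; first exact: represents_representing_measure ext mu_rep.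
  move=> nu nu_rep.
  (* Every representing measure nu of gamma extends to the same delta, so nu and mu both represent
     delta and [represents_unique] applies. *)
  have E := uniq_delta _ (extension_of_dim_extension nu_rep).
  have nu_delta := extension_of_represents nu_rep.
  by apply: (@represents_unique _ _ delta nu mu) => //; rewrite E.
Qed.
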